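(* Let $k\ge 2$ and let $Q\subset\mathbb{R}^k$ be a $k$-polytope with vertices $w_1,\dots,w_n$ that contains the origin in its interior, and let $M=M(Q)$ be Izmestiev's Colin de Verdière matrix of $Q$. If $Q$ is simple and $w_s,w_t$ is a pair of vertices that form an edge of $Q$, then $$M_{st}=-\frac{1}{(k-2)!}\cdot\frac{\operatorname{vol}_k(\mathcal{E})^{k-2}}{\prod_{j\in[k]\setminus\{r\}}|\langle w_s,q_j\rangle|},$$ where $v_1,\dots,v_k$ are the neighbours of $v_0:=w_s$ in $Q$, with $v_r=w_t$, $\varepsilon_j=v_j-v_0$ for $j\in[k]$, $q_j=(-1)^{j-1}\varepsilon_1\times\cdots\times\widehat{\varepsilon}_j\times\cdots\times\varepsilon_k$, and $\mathcal{E}$ is the parallelepiped spanned by $\varepsilon_1,\dots,\varepsilon_k$.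
   Context: A $k$-polytope is a $k$-dimensional convex polytope; it is simple if each vertex is incident to exactly $k$ edges. $[n]=\{1,\dots,n\}$. Let $G$ be the vertex-edge graph of $Q$, with vertex set $[n]$ ($s$ corresponding to $w_s$), and let $P=\{p\in\mathbb{R}^k\mid\langle p,w_s\rangle\le1\ \text{for all } s\in[n]\}$ be the polar dual of $Q$. For an edge $st$ of $G$ let $F_{st}$ be the ridge ($(k-2)$-face) of $P$ obtained as the intersection of the facets of $P$ with outer normals $w_s$ and $w_t$, and let $\theta_{st}$ be the dihedral angle of $P$ at $F_{st}$. Izmestiev's matrix $M(Q)\in\mathbb{R}^{n\times n}$ is the symmetric matrix with off-diagonal entries $$M_{st}=-\frac{\operatorname{vol}_{k-2}(F_{st})}{\|w_s\|\,\|w_t\|\sin\theta_{st}}\ \text{ if } st \text{ is an edge of } G,\qquad M_{st}=0\ \text{ if } s\ne t \text{ and } st \text{ is not an edge,}$$ and with diagonal entries determined by $M_{ss}w_s=-\sum_{t\ne s}M_{st}w_t$. The generalized vector product $u_1\times\cdots\times u_{k-1}\in\mathbb{R}^k$ is determined by $\langle x,u_1\times\cdots\times u_{k-1}\rangle=\det(x,u_1,\dots,u_{k-1})$ for all $x\in\mathbb{R}^k$; $\widehat{\varepsilon}_j$ means that the factor is omitted. $\operatorname{vol}_d$ is $d$-dimensional Euclidean volume, with $\operatorname{vol}_0$ of a point equal to $1$. *)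

(* Defs.v *)
From HB Require Import structures.
From mathcomp Require Import all_boot all_order all_algebra.
From mathcomp Require Import all_classical all_reals all_analysis.

Set Implicit Arguments.
Unset Strict Implicit.
Unset Printing Implicit Defensive.

Import Order.TTheory GRing.Theory Num.Theory.
Import numFieldNormedType.Exports.

Local Open Scope classical_set_scope.
Local Open Scope ring_scope.

Section Euclidean.
Variables (R : realType) (k : nat).
Implicit Types x y u v : 'rV[R]_k.

Definition dotv u v : R := \sum_(i < k) u 0 i * v 0 i.

(* The library norm on matrices is the sup norm, hence this definition. *)
Definition enorm u : R := Num.sqrt (dotv u u).

Definition rows_mx (s : seq 'rV[R]_k) : 'M[R]_k :=
  \matrix_(i < k) nth 0 s i.

(* j-th coordinate: <e_j, u_1 x ... x u_(k-1)> = det (e_j, u_1, ..., u_(k-1));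
   see dotv_cross for the characterization on all vectors. *)
Definition cross (u : 'I_k.-1 -> 'rV[R]_k) : 'rV[R]_k :=
  \row_j \det (rows_mx (delta_mx 0 j :: codom u)).

End Euclidean.

Lemma dotv_cross (R : realType) (k : nat) (u : 'I_k.-1 -> 'rV[R]_k)
    (x : 'rV[R]_k) : (0 < k)%N ->
  dotv x (cross u) = \det (rows_mx (x :: codom u)).
Proof.
case: k u x => // k u x _.
rewrite (expand_det_row _ ord0); apply: eq_bigr => j _.
rewrite !mxE /=; congr (_ * _).
rewrite (expand_det_row _ ord0) (bigD1 j) //= big1 ?addr0; last first.
  by move=> i /negPf nij; rewrite !mxE /= nij mul0r.
rewrite !mxE /= eqxx mul1r /cofactor; congr (_ * \det _).
by apply/matrixP => a b; rewrite !mxE.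
Qed.

Section Volume.
Variable R : realType.

(* Lebesgue measure on R^d as the d-fold product of the one-dimensional
   Lebesgue measure, computed by sections as in [product_measure1].
   It is meant for Borel sets only. *)
Fixpoint lebesgue_rV (d : nat) : set 'rV[R]_d -> \bar R :=
  match d return set 'rV[R]_d -> \bar R with
  | 0 => fun A => (\1_A 0)%:E
  | d'.+1 => fun A => (\int[lebesgue_measure]_(x in setT)
      lebesgue_rV [set y : 'rV[R]_d' | A (row_mx (x%:M : 'M[R]_1) y)])%E
  end.

Definition isometric_chart (d k : nat) (S : set 'rV[R]_k)
    (c : 'rV[R]_k * 'M[R]_(d, k)) : Prop :=
  c.2 *m c.2^T = 1%:M /\ S `<=` range (fun x : 'rV[R]_d => c.1 + x *m c.2).

(* d-dimensional Euclidean volume of a (bounded, Borel) subset S of a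
   d-dimensional affine subspace of R^k: S is pulled back to R^d along an
   isometric parametrization of that subspace. The result does not depend on
   the parametrization, because Lebesgue measure is invariant under
   isometries. *)
Definition vol (d k : nat) (S : set 'rV[R]_k) : R :=
  let c := xget (0, 0) [set c | isometric_chart (d := d) S c] in
  fine (lebesgue_rV [set x : 'rV[R]_d | S (c.1 + x *m c.2)]).

Definition parallelepiped (m k : nat) (e : 'I_m -> 'rV[R]_k) : set 'rV[R]_k :=
  [set x | exists2 a : 'I_m -> R,
    (forall i, 0 <= a i <= 1) & x = \sum_i a i *: e i].

End Volume.

Section Polytopes.
Variables (R : realType) (k : nat).
Implicit Types (S F Q : set 'rV[R]_k) (x y : 'rV[R]_k).

Definition conv_hull (m : nat) (p : 'I_m -> 'rV[R]_k) : set 'rV[R]_k :=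
  [set x | exists a : 'I_m -> R,
    [/\ forall i, 0 <= a i, \sum_i a i = 1 & x = \sum_i a i *: p i]].

Definition in_flat (d : nat) S : Prop :=
  exists (a : 'rV[R]_k) (B : 'M[R]_(d, k)),
    S `<=` range (fun x : 'rV[R]_d => a + x *m B).

(* dimension of the affine hull of S *)
Definition has_dim (d : nat) S : Prop :=
  [/\ S !=set0, in_flat d S & forall e, in_flat e S -> (d <= e)%N].

Definition polytope (d : nat) Q : Prop :=
  (exists (m : nat) (p : 'I_m -> 'rV[R]_k), Q = conv_hull p) /\ has_dim d Q.

Definition face Q F : Prop :=
  exists (c : 'rV[R]_k) (b : R),
    (forall x, Q x -> dotv c x <= b) /\ F = [set x | Q x /\ dotv c x = b].

Definition vertices Q : set 'rV[R]_k := [set x | face Q [set x]].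

Definition segment x y : set 'rV[R]_k :=
  [set z | exists2 a : R, 0 <= a <= 1 & z = (1 - a) *: x + a *: y].

Definition edge Q x y : Prop := x <> y /\ face Q (segment x y).

Definition neighbours Q x : set 'rV[R]_k := [set y | edge Q x y].

End Polytopes.

Section Izmestiev.
Variables (R : realType) (k n : nat).
Variables (Q : set 'rV[R]_k) (w : 'I_n -> 'rV[R]_k).

Definition graph : rel 'I_n := fun s t => `[< edge Q (w s) (w t) >].

Definition simple_polytope : Prop :=
  forall s, #|[set t : 'I_n | graph s t]%SET| = k.

Definition polar_dual : set 'rV[R]_k :=
  [set p | forall s, dotv p (w s) <= 1].

Definition facet (s : 'I_n) : set 'rV[R]_k :=
  [set p | polar_dual p /\ dotv p (w s) = 1].

Definition ridge (s t : 'I_n) : set 'rV[R]_k := facet s `&` facet t.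

(* Interior dihedral angle between two facets with outer normals u and v. *)
Definition dihedral_angle (u v : 'rV[R]_k) : R :=
  pi - acos (dotv u v / (enorm u * enorm v)).

Definition izmestiev_offdiag (s t : 'I_n) : R :=
  if graph s t then
    - (vol (k - 2) (ridge s t) /
       (enorm (w s) * enorm (w t) * sin (dihedral_angle (w s) (w t))))
  else 0.

(* The scalar m is unique since w s <> 0; its existence is a theorem of
   Izmestiev. *)
Definition izmestiev_diag (s : 'I_n) : R :=
  xget 0 [set m | m *: w s
                  = - \sum_(t | t != s) izmestiev_offdiag s t *: w t].

Definition izmestiev_mx : 'M[R]_n :=
  \matrix_(s, t) if s == t then izmestiev_diag s else izmestiev_offdiag s t.

End Izmestiev.

(* Main.v *)
(** Writing Q = conv(p_i), a theorem of alternatives shows that a minimal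
    family of generators of a pointed polyhedral cone spans exposed rays; hence
    Q lies in the cone at w_s spanned by the edge vectors e_j = v_j - w_s, and
    every point of Q is a convex combination of vertices. As 0 is interior to
    Q, the e_j form a basis and - w_s = sum_j c_j e_j with all c_j > 0, so that
    |<w_s, q_j>| = c_j |det e|, while the ridge of the polar dual is the simplex
    whose vertices are the vectors - e_j^* / c_j for j <> r, where e^* is the
    basis dual to e. If P has as rows the differences of these vertices and W
    has rows e_r and w_s, then W P^T = 0, and comparing the matrices (W; P) and
    (W; e_j, j <> r, j_0) gives
      sqrt(det(P P^T)) / sqrt(det(W W^T)) = 1 / (|det e| prod_(j <> r) c_j),
    where sqrt(det(W W^T)) = |w_s| |w_t| sin(theta_st) and
    sqrt(det(P P^T)) / (k-2)! is the volume of the ridge. The latter uses the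
    change of variables formula for linear maps, proved by LUP decomposition. *)

Require Import Defs.
From HB Require Import structures.
From mathcomp Require Import all_boot all_order all_algebra.
From mathcomp Require Import all_classical all_reals all_analysis.
From mathcomp Require Import fingroup perm measurable_realfun.
From mathcomp Require Import ring lra.

Set Implicit Arguments.
Unset Strict Implicit.
Unset Printing Implicit Defensive.

Import Order.TTheory GRing.Theory Num.Theory.
Import numFieldNormedType.Exports.

Local Open Scope classical_set_scope.
Local Open Scope ring_scope.

(** * Lebesgue measure on row vectors *)

Section BorelRows.
Variable R : realType.
Notation Rm := (measurableTypeR R).

(** Cylinders generate the product sigma-algebra, so a map into [row_sigma d] is measurable as soon
    as its coordinates are. *)
Definition coord_sets d : set (set 'rV[R]_d) :=
  [set A | exists (i : 'I_d) (B : set Rm),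
    measurable B /\ A = [set x : 'rV[R]_d | B (x 0 i)]].

Definition row_sigma d := g_sigma_algebraType (@coord_sets d).

Lemma measurable_coord d (i : 'I_d) :
  measurable_fun setT (fun x : row_sigma d => x 0 i : Rm).
Proof.
move=> _ B mB; rewrite setTI; apply: sub_sigma_algebra.
by exists i, B.
Qed.

Lemma measurable_row d' (T : measurableType d') d (f : T -> row_sigma d) :
  (forall i, measurable_fun setT (fun x => f x 0 i : Rm)) ->
  measurable_fun setT f.
Proof.
move=> mf.
apply: (@measurability _ _ _ (row_sigma d) setT f (@coord_sets d)) => //.
move=> _ [_ [i [B [mB ->]]] <-].
by rewrite setTI -(setTI (_ @^-1` _)); exact: mf.
Qed.

(** Uses the same [row_mx] as [lebesgue_rV], so that the sections of a preimage under [row_cons] are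
    the sets integrated there. *)
Definition row_cons d (p : Rm * row_sigma d) : row_sigma d.+1 :=
  row_mx (p.1%:M : 'M[R]_1) p.2.

Lemma row_cons0 d (p : Rm * row_sigma d) : row_cons p 0 0 = p.1.
Proof.
have -> : 0 = lshift d (0 : 'I_1) by apply: val_inj.
by rewrite [LHS]row_mxEl mxE mulr1n.
Qed.

Lemma row_consS d (p : Rm * row_sigma d) i :
  row_cons p 0 (lift 0 i) = p.2 0 i.
Proof.
have -> : lift 0 i = rshift 1 i by apply: val_inj.
by rewrite [LHS]row_mxEr.
Qed.

Lemma measurable_row_cons d : measurable_fun setT (@row_cons d).
Proof.
apply: measurable_row => i; case: (unliftP ord0 i) => [j|] ->.
  under eq_fun do rewrite row_consS.
  exact: (measurableT_comp (@measurable_coord d j) measurable_snd).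
by under eq_fun do rewrite row_cons0; exact: measurable_fst.
Qed.

Definition box d (B : 'I_d -> set Rm) : set (row_sigma d) :=
  [set x | forall i, B i (x 0 i)].

Lemma preimage_row_cons_box d (B : 'I_d.+1 -> set Rm) :
  @row_cons d @^-1` box B = B ord0 `*` box (fun i => B (lift ord0 i)).
Proof.
apply/seteqP; split=> -[x y] /= => [h|[h0 hS] i].
  split=> [|i /=]; first by have := h 0; rewrite row_cons0.
  by have := h (lift 0 i); rewrite row_consS.
by case: (unliftP ord0 i) => [j|] ->; rewrite ?row_cons0// row_consS; exact: hS.
Qed.

Lemma measurable_box d (B : 'I_d -> set Rm) :
  (forall i, measurable (B i)) -> measurable (box B).
Proof.
move=> mB.
have -> : box B = \big[setI/setT]_(i < d) [set x : row_sigma d | B i (x 0 i)].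
  rewrite -bigcap_seq; apply/seteqP; split=> x /= h i => [_|]; first exact: h.
  by apply: (h i); rewrite /= mem_index_enum.
apply: bigsetI_measurable => i _.
by apply: sub_sigma_algebra; exists i, (B i).
Qed.

Section step.
Variables (d : nat) (m : {sigma_finite_measure set (row_sigma d) -> \bar R}).

(** The product measure carried over to rows; iterating it realizes [lebesgue_rV] by a genuine
    sigma-finite measure. *)
Definition cons_measure : set (row_sigma d.+1) -> \bar R :=
  pushforward ((@lebesgue_measure R) \x m)%E (@row_cons d).

Let mrc := @measurable_row_cons d.

Let m0 : cons_measure set0 = 0%E.
Proof. by rewrite /cons_measure /pushforward preimage_set0 measure0. Qed.

Let m_ge0 A : (0 <= cons_measure A)%E.
Proof. exact: measure_ge0. Qed.

Let m_sigma_additive : semi_sigma_additive cons_measure.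
Proof.
exact: (@measure_semi_sigma_additive _ _ _
  (pushforward ((@lebesgue_measure R) \x m)%E (@row_cons d))).
Qed.

HB.instance Definition _ := isMeasure.Build _ _ _ cons_measure
  m0 m_ge0 m_sigma_additive.

Definition row_uncons (x : row_sigma d.+1) : Rm * row_sigma d :=
  (x 0 0, \row_i x 0 (lift 0 i)).

Let row_consK : cancel (@row_cons d) row_uncons.
Proof.
move=> [x y]; rewrite /row_uncons row_cons0; congr pair.
by apply/rowP => i; rewrite mxE row_consS.
Qed.

Let measurable_row_uncons : measurable_fun setT row_uncons.
Proof.
apply/measurable_fun_pair; first exact: measurable_coord.
apply: measurable_row => i; under eq_fun do rewrite mxE.
exact: measurable_coord.
Qed.

Let m_sigma_finite : sigma_finite setT cons_measure.
Proof.
have /sigma_finiteP[F [FT ndF Foo]] := sigma_finiteT (@lebesgue_measure R).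
have /sigma_finiteP[G [GT ndG Goo]] := sigma_finiteT m.
have mFG n : measurable (F n `*` G n).
  by apply: measurableX; [case: (Foo n)|case: (Goo n)].
exists (fun n => row_uncons @^-1` (F n `*` G n)).
  apply/seteqP; split=> // x _.
  have [i _ Fi] : (\bigcup_n F n) (row_uncons x).1 by rewrite -FT.
  have [j _ Gj] : (\bigcup_n G n) (row_uncons x).2 by rewrite -GT.
  (* Both sequences are nondecreasing, so a common index serves for the two factors. *)
  exists (maxn i j) => //; split.
    by move: Fi; exact/subsetPset/ndF/leq_maxl.
  by move: Gj; exact/subsetPset/ndG/leq_maxr.
move=> n; split.
  by rewrite -[X in measurable X]setTI; exact: measurable_row_uncons.
rewrite /cons_measure /pushforward -comp_preimage.
have -> : row_uncons \o @row_cons d = id.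
  by apply/funext => x /=; rewrite row_consK.
have [? ?] := Foo n; have [? ?] := Goo n.
by rewrite preimage_id product_measure1E// lte_mul_pinfty// ge0_fin_numE.
Qed.

HB.instance Definition _ := Measure_isSigmaFinite.Build _ _ _ cons_measure
  m_sigma_finite.

End step.

Fixpoint leb d : {sigma_finite_measure set (row_sigma d) -> \bar R} :=
  match d with
  | 0 => dirac (0 : row_sigma 0)
  | d'.+1 => cons_measure (leb d')
  end.

(** Holds for all sets, because the product measure is by definition the integral of the measures of
    the sections. *)
Lemma lebE d (A : set 'rV[R]_d) : leb d A = lebesgue_rV A.
Proof.
elim: d A => //= d IH A; apply: eq_integral => x _ /=.
by rewrite -IH xsectionE.
Qed.

Lemma lebS d (A : set 'rV[R]_d.+1) :
  leb d.+1 A = (\int[lebesgue_measure]_x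
    leb d [set y | A (row_mx (x%:M : 'M[R]_1) y)])%E.
Proof.
by rewrite lebE; apply: eq_integral => x _; rewrite lebE.
Qed.

Lemma leb_box d (B : 'I_d -> set Rm) : (forall i, measurable (B i)) ->
  leb d (box B) = (\big[*%E/1]_(i < d) lebesgue_measure (B i))%E.
Proof.
elim: d B => [|d IH] B mB.
  rewrite big_ord0 /= diracE mem_set//= => i; by case: i.
rewrite big_ord_recl -IH//= /cons_measure /pushforward preimage_row_cons_box.
by rewrite product_measure1E//; exact: measurable_box.
Qed.

(** Boxes are stable under intersection and generate the sigma-algebra, and the cubes [-n, n]^d have
    finite measure and exhaust the space. *)
Lemma leb_unique d (m : {measure set (row_sigma d) -> \bar R}) :
  (forall B, (forall i, measurable (B i)) -> leb d (box B) = m (box B)) ->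
  forall A, measurable A -> leb d A = m A.
Proof.
move=> mE A mA.
pose G := [set A : set (row_sigma d) | exists2 B : 'I_d -> set Rm,
  (forall i, measurable (B i)) & A = box B].
apply: (measure_unique G
  (fun n => box (fun=> `[- n%:R, n%:R]%classic : set Rm))) => //.
- apply/seteqP; split; apply: smallest_sub; try exact: smallest_sigma_algebra.
    move=> _ [i [B [mB ->]]]; apply: sub_sigma_algebra.
    exists (fun j => if j == i then B else setT).
      by move=> j; case: ifP.
    apply/seteqP; split=> x /= => [Bx j|/(_ i)]; last by rewrite eqxx.
    by case: eqP => [->|].
  by move=> _ [B mB ->]; exact: measurable_box.
- move=> _ _ [B mB ->] [C mC ->]; exists (fun i => B i `&` C i).
    by move=> i; exact: measurableI.
  apply/seteqP; split=> x /= => [[h1 h2] i|h]; first by split.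
  by split=> i; case: (h i).
- by move=> n; exists (fun=> `[- n%:R, n%:R]%classic) => // i.
- apply/seteqP; split=> // x _.
  exists (Num.truncn (\sum_i `|x 0 i|)).+1 => // i /=.
  rewrite in_itv/= -ler_norml.
  apply: (le_trans _ (ltW (truncnS_gt _))).
  by rewrite (bigD1 i) //= lerDl sumr_ge0.
- by move=> _ [B mB ->]; exact: mE.
- move=> n; rewrite /= leb_box//.
  (* For n = 0 the interval is a point, and n - (-n) is still its length. *)
  rewrite (@eq_bigr _ _ _ _ _ _ _ (fun=> (n%:R - - n%:R)%:E)); last first.
    move=> i _; rewrite lebesgue_measure_itv/= lte_fin.
    case: ltP => //; rewrite -subr_ge0 opprK => h.
    have : (0 : R) <= n%:R by [].
    by move: h; move: (n%:R : R) => z ? ?; congr EFin; lra.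
  suff [r ->] : exists r : R, \big[*%E/1%E]_(i < d) (n%:R - - n%:R)%:E = r%:E.
    exact: ltry.
  elim/big_ind: _ => [|x y [r ->] [r' ->]|i _]; first by exists 1.
    by exists (r * r').
  by eexists.
Qed.
End BorelRows.

(** * Affine changes of variables *)

Section AffineLebesgue.
Variable R : realType.
Notation Rm := (measurableTypeR R).
Notation mu := (@lebesgue_measure R).

Lemma measurable_affine1 (a b : R) :
  measurable_fun setT ((fun x => a * x + b) : Rm -> Rm).
Proof. by apply: measurable_funD => //; exact: measurable_funM. Qed.

(** The image measure scaled by |a| gives each half-open interval its length, hence is Lebesgue
    measure by uniqueness. *)
Lemma lebesgue_measure_affine (a b : R) (A : set Rm) : a != 0 ->
  measurable A ->
  mu ((fun x => a * x + b) @^-1` A) = (`|a|^-1%:E * mu A)%E.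
Proof.
move=> a0 mA; have ma := measurable_affine1 a b.
have na0 : 0 < `|a| by rewrite normr_gt0.
pose k := NngNum (ltW na0).
have := @lebesgue_measure_unique R (mscale k
  [the {measure set Rm -> \bar R} of
    pushforward mu ((fun x => a * x + b) : Rm -> Rm)]).
move=> /(_ ma _ _ mA) ->; last first.
  move=> _ [[u v]] _ <-; rewrite /mscale/= /pushforward.
  set I := [set` `]u, v]].
  have /= itvE (x y : R) : mu `]x, y]%classic = (if x < y then (y - x)%:E else 0%E).
    by rewrite lebesgue_measure_itv/= lte_fin EFinB.
  rewrite itvE.
  move: a0; rewrite /k /=; case: (ltgtP a 0) => // a0 _.
    (* A negative slope reverses the interval, so the preimage is closed on the left and open on the
       right. *)
    pose J : set R := `[(v - b) / a, (u - b) / a[%classic.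
    transitivity (`|a|%:E * mu J)%E; last first.
      congr (_ * mu _)%E; apply/seteqP; split=> x; rewrite /I /J /= !in_itv/=;
        rewrite ler_ndivrMr// ltr_ndivlMr// => /andP[? ?]; apply/andP; split; lra.
    rewrite /J lebesgue_measure_itv/= !lte_fin ltr_nM2r ?invr_lt0// ltrD2r.
    case: ifP => _; rewrite ?mule0// -EFinB -EFinM ltr0_norm//; congr EFin.
    by field; rewrite lt_eqF.
  pose J : set R := `](u - b) / a, (v - b) / a]%classic.
  transitivity (`|a|%:E * mu J)%E; last first.
    congr (_ * mu _)%E; apply/seteqP; split=> x; rewrite /I /J /= !in_itv/=;
      rewrite ler_pdivlMr// ltr_pdivrMr// => /andP[? ?]; apply/andP; split; lra.
  rewrite /J itvE ltr_pM2r ?invr_gt0// ltrD2r.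
  case: ifP => _; rewrite ?mule0// -EFinM gtr0_norm//; congr EFin.
  by field; rewrite gt_eqF.
by rewrite /mscale/= /pushforward/= muleA -EFinM mulVf ?mul1e// gt_eqF.
Qed.

Lemma ge0_integral_affine (a b : R) (g : Rm -> \bar R) : a != 0 ->
  measurable_fun setT g -> (forall x, 0 <= g x)%E ->
  (\int[mu]_x g (a * x + b)%R = `|a|^-1%:E * \int[mu]_x g x)%E.
Proof.
move=> a0 mg g0; have ma := measurable_affine1 a b.
have na0 : 0 <= `|a|^-1 by rewrite invr_ge0.
pose k := NngNum na0.
transitivity (\int[mscale k mu]_x g x)%E; last by rewrite ge0_integral_mscale.
transitivity (\int[pushforward mu ((fun x => a * x + b)%R : Rm -> Rm)]_x g x)%E.
  by rewrite ge0_integral_pushforward.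
apply: eq_measure_integral => A mA _.
exact: (lebesgue_measure_affine b a0 mA).
Qed.

Lemma measurable_rowM d (M : 'M[R]_d) :
  measurable_fun setT ((fun x => x *m M) : row_sigma R d -> row_sigma R d).
Proof.
apply: measurable_row => i; under eq_fun do rewrite mxE.
apply: measurable_sum => j; apply: measurable_funM => //.
exact: measurable_coord.
Qed.

Lemma measurable_rowD d (a : 'rV[R]_d) :
  measurable_fun setT ((fun x => x + a) : row_sigma R d -> row_sigma R d).
Proof.
apply: measurable_row => i; under eq_fun do rewrite mxE.
by apply: measurable_funD => //; exact: measurable_coord.
Qed.

(** By [leb_unique] only boxes matter, and these are translated coordinate by coordinate. *)
Lemma leb_translate d (a : 'rV[R]_d) (A : set (row_sigma R d)) : measurable A ->
  leb R d [set x | A (x + a)] = leb R d A.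
Proof.
move=> mA; have mt := measurable_rowD a.
have := @leb_unique R d [the {measure set (row_sigma R d) -> \bar R} of
  pushforward (leb R d) ((fun x => x + a) : row_sigma R d -> row_sigma R d)].
move=> /(_ mt _ _ mA) -> // B mB; rewrite /= /pushforward.
have -> : (fun x : row_sigma R d => x + a : row_sigma R d) @^-1` box B =
    box (fun i => (fun x : Rm => 1 * x + a 0 i) @^-1` B i).
  by apply/seteqP; split=> x h i; have := h i; rewrite /= mxE mul1r.
rewrite !leb_box//; last first.
  by move=> i; rewrite -[X in measurable X]setTI; exact: measurable_affine1.
apply: eq_bigr => i _.
by rewrite lebesgue_measure_affine ?oner_eq0// normr1 invr1 mul1e.
Qed.

Lemma leb_perm d (s : 'S_d) (A : set (row_sigma R d)) : measurable A ->
  leb R d [set x | A (x *m perm_mx s)] = leb R d A.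
Proof.
move=> mA; have mt := measurable_rowM (perm_mx s : 'M[R]_d).
have := @leb_unique R d [the {measure set (row_sigma R d) -> \bar R} of
  pushforward (leb R d)
    ((fun x => x *m perm_mx s) : row_sigma R d -> row_sigma R d)].
move=> /(_ mt _ _ mA) -> // B mB; rewrite /= /pushforward.
have -> : (fun x : row_sigma R d => x *m perm_mx s : row_sigma R d) @^-1` box B =
    box (fun i => B (s i)).
  apply/seteqP; split=> x h i; have := h _.
    by move=> /(_ (s i)); rewrite -[s]invgK -col_permE mxE invgK permK.
  by move=> /(_ (s^-1 i)%g); rewrite -[s]invgK -col_permE mxE invgK permKV.
rewrite !leb_box//; exact: (reindex_inj (@perm_inj _ s)).
Qed.

(** Preimages are measured, hence the inverse of the determinant. The property is stable under
    products, so that it can be checked on the factors of an LUP decomposition. *)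
Definition lebesgue_scales d (M : 'M[R]_d) := forall A : set (row_sigma R d),
  measurable A -> leb R d [set x | A (x *m M)] = (`|\det M|^-1%:E * leb R d A)%E.

Lemma lebesgue_scalesM d (M N : 'M[R]_d) :
  lebesgue_scales M -> lebesgue_scales N -> lebesgue_scales (M *m N).
Proof.
move=> hM hN A mA.
transitivity (leb R d [set x | [set y : row_sigma R d | A (y *m N)] (x *m M)]).
  by congr (leb R d _); apply/funext => x /=; rewrite mulmxA.
rewrite hM; last by rewrite -[X in measurable X]setTI; exact: measurable_rowM.
by rewrite hN// muleA -EFinM det_mulmx normrM invfM.
Qed.

Lemma lebesgue_scales_perm d (s : 'S_d) : lebesgue_scales (perm_mx s).
Proof.
move=> A mA; rewrite leb_perm// det_perm normrX normrN1 expr1n invr1.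
by rewrite mul1e.
Qed.

(* The section over x of the preimage of A is the preimage of a translate of
   the section of A over U_00 x under the lower right block of U. *)
Lemma lebesgue_scales_upper d (U : 'M[R]_d) : (forall i j : 'I_d, (j < i)%N -> U i j = 0) ->
  \det U != 0 -> lebesgue_scales U.
Proof.
elim: d U => [|d IH] U Uup dU A mA.
  rewrite (_ : [set x | A (x *m U)] = A); last first.
    by apply/funext => x /=; congr (A _); apply/rowP => -[].
  by rewrite det_mx00 normr1 invr1 mul1e.
pose V : 'M[R]_(1 + d) := U; pose u := U 0 0; pose U' := drsubmx V.
have dl0 : dlsubmx V = 0.
  by apply/matrixP => i j; rewrite !mxE Uup//= (ord1 j).
have ulE : ulsubmx V = u%:M.
  rewrite [LHS]mx11_scalar; congr (_%:M); rewrite !mxE.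
  by congr (U _ _); apply: val_inj.
have VE : V = block_mx u%:M (ursubmx V) 0 U' by rewrite -[LHS]submxK dl0 ulE.
have dUE : \det U = u * \det U'.
  transitivity (\det (block_mx u%:M (ursubmx V) 0 U')); first by rewrite -VE.
  by rewrite det_ublock det_scalar1.
have [u0 dU'] : u != 0 /\ \det U' != 0.
  by apply/andP; rewrite -negb_or -mulf_eq0 -dUE.
pose g x := leb R d [set y | A (row_mx (x%:M : 'M[R]_1) y)].
have mrow x : measurable [set y : row_sigma R d | A (row_mx (x%:M : 'M[R]_1) y)].
  have := measurable_xsection x (measurable_row_cons measurableT mA).
  by rewrite setTI xsectionE.
have mg : measurable_fun setT (g : Rm -> _).
  have := measurable_fun_xsection (leb R d) (measurable_row_cons measurableT mA).
  rewrite setTI; congr measurable_fun; apply/funext => x /=.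
  by rewrite xsectionE.
rewrite lebS.
transitivity (\int[mu]_x (`|\det U'|^-1%:E * g (u * x + 0)%R))%E; last first.
  rewrite ge0_integralZl//.
  - rewrite ge0_integral_affine// muleA -EFinM dUE normrM invfM mulrC.
    by rewrite -lebS.
  - by apply: (measurableT_comp mg); exact: measurable_affine1.
apply: eq_integral => x _; rewrite /g.
pose c : 'rV[R]_d := (x%:M : 'M[R]_1) *m ursubmx V.
transitivity (leb R d [set y | [set z : row_sigma R d |
    A (row_mx ((u * x + 0)%:M : 'M[R]_1) (z + c))] (y *m U')]).
  congr (leb R d _); apply/funext => y /=; congr (A _).
  transitivity (row_mx x%:M y *m block_mx u%:M (ursubmx V) 0 U'); first by rewrite -VE.
  rewrite [LHS](@mul_row_block _ 1 1 d 1 d) mulmx0 addr0.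
  by rewrite -scalar_mxM addr0 mulrC addrC.
rewrite IH//; last first.
- by have := measurable_rowD c measurableT (mrow (u * x + 0)); rewrite setTI.
- by move=> i j ji; rewrite !mxE Uup.
congr (_ * _)%E.
exact: (@leb_translate d c [set z | A (row_mx ((u * x + 0)%:M : 'M[R]_1) z)]).
Qed.

(** Conjugation by the order-reversing permutation makes a lower triangular matrix upper
    triangular. *)
Lemma lebesgue_scales_lower d (L : 'M[R]_d) : (forall i j : 'I_d, (i < j)%N -> L i j = 0) ->
  \det L != 0 -> lebesgue_scales L.
Proof.
move=> Llow dL; pose s := perm (@rev_ord_inj d).
pose U : 'M[R]_d := \matrix_(i, j) L (rev_ord i) (rev_ord j).
have LE : L = perm_mx s *m (U *m perm_mx s).
  have sV : (s^-1 = s)%g.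
    by apply/permP => i; apply: (canLR (permK s)); rewrite !permE rev_ordK.
  have <- : col_perm s U = U *m perm_mx s by rewrite col_permE sV.
  rewrite -row_permE; apply/matrixP => i j.
  by rewrite !mxE !permE !rev_ordK.
rewrite LE; do 2?apply: lebesgue_scalesM; try exact: lebesgue_scales_perm.
apply: lebesgue_scales_upper.
  by move=> i j ji; rewrite mxE Llow//= ltn_sub2l// (leq_trans _ (ltn_ord i)).
by move: dL; rewrite LE !det_mulmx !mulf_eq0 !negb_or => /and3P[].
Qed.

Lemma lebesgue_scales_unitmx d (M : 'M[R]_d) : M \in unitmx -> lebesgue_scales M.
Proof.
case: d M => [|d] M uM.
  by apply: lebesgue_scales_upper => [[]//|]; rewrite det_mx00 oner_eq0.
(* From P M = L U with P a permutation matrix, M is the product of the inverse permutation, L and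
   U. *)
have := cormen_lup_correct M; have := cormen_lup_detL M.
have := @cormen_lup_lower _ _ M; have := @cormen_lup_upper _ _ M.
have := cormen_lup_perm M; case: cormen_lup => [[P L] U] /=.
move=> /is_perm_mxP[s ->] Uup Llow dL PM.
have ME : M = perm_mx s^-1%g *m (L *m U).
  by rewrite [L *m U](esym PM) mulmxA -perm_mxM mulVg perm_mx1 mul1mx.
have dLU : \det L * \det U != 0.
  by rewrite -det_mulmx [L *m U](esym PM) det_mulmx mulf_neq0 //
    -unitfE -?unitmxE// unitmx_perm.
rewrite mulf_eq0 negb_or in dLU; case/andP: dLU => dL0 dU0.
rewrite ME; apply: lebesgue_scalesM; first exact: lebesgue_scales_perm.
apply: lebesgue_scalesM; last exact: lebesgue_scales_upper.
apply: lebesgue_scales_lower => // i j ij.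
by rewrite Llow 1?ltnW// (_ : i == j = false)//; apply/eqP => e; rewrite e ltnn in ij.
Qed.
End AffineLebesgue.

(** * Measure of the standard simplex *)

Section Simplex.
Variable R : realType.
Notation Rm := (measurableTypeR R).
Notation mu := (@lebesgue_measure R).

(** The integral met in the induction on the dimension, where (t - x)^n / n! is the measure of the
    section at x. The case t = 0 is separate since the fundamental theorem is applied on a
    nondegenerate interval. *)
Lemma integral_power (n : nat) (t : R) : 0 <= t ->
  (\int[mu]_(x in `[0%R, t]) ((t - x) ^+ n / n`!%:R)%:E =
   (t ^+ n.+1 / n.+1`!%:R)%:E)%E.
Proof.
rewrite le_eqVlt => /predU1P[<-|t0].
  by rewrite set_itv1 integral_set1 expr0n/= mul0r.
pose F (x : R) : R := - (t - x) ^+ n.+1 / n.+1`!%:R.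
have dF (x : R) : is_derive x (1 : R) F ((t - x) ^+ n / n`!%:R).
  have -> : F = (- n.+1`!%:R^-1) *: ((cst t - id) ^+ n.+1 : R -> R).
    by apply/funext => y; rewrite /F fctE mulNr mulrC -mulNr.
  apply: is_derive_eq.
  rewrite /GRing.scale /= factS natrM.
  have : n.+1%:R != 0 :> R by rewrite pnatr_eq0.
  have : n`!%:R != 0 :> R by rewrite pnatr_eq0 -lt0n fact_gt0.
  by move: (n.+1%:R : R) (n`!%:R : R) ((t - x) ^+ n) => a b c *; field; apply/andP.
have cF : continuous F.
  by move=> x; apply: differentiable_continuous; apply/derivable1_diffP.
rewrite (@continuous_FTC2 _ _ F)//.
- rewrite /F subrr expr0n/= subr0 oppr0 mul0r -EFinB.
  by rewrite sub0r mulNr opprK.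
- apply: continuous_subspaceT => x.
  apply: cvgM; last exact: cvg_cst.
  apply: (@continuous_comp _ _ _ (fun x => t - x) (fun x => x ^+ n)).
    by apply: (@cvgB _ R^o); [exact: cvg_cst|exact: cvg_id].
  exact: exprn_continuous.
- split => [x _| |]; first by [].
    by apply: cvg_at_right_filter; exact: cF.
  by apply: cvg_at_left_filter; exact: cF.
- by move=> x _; rewrite derive1E; apply: derive_val.
Qed.

Definition simplex_le d (t : R) : set (row_sigma R d) :=
  [set x | (forall i, 0 <= x 0 i) /\ \sum_i x 0 i <= t].

(** The section at x in [0, t] is the simplex of size t - x, and any other section is empty; this is
    why the size t varies in the induction. *)
Lemma leb_simplex_le d (t : R) : 0 <= t ->
  leb R d (simplex_le t) = (t ^+ d / d`!%:R)%:E.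
Proof.
elim: d t => [|d IH] t t0.
  by rewrite /= diracE mem_set /= ?expr0 ?divr1//; split=> [[]|]//; rewrite big_ord0.
rewrite lebS -integral_power// [RHS]integral_mkcond.
apply: eq_integral => x _; rewrite patchE.
have rowE (y : 'rV[R]_d) : @simplex_le d.+1 t (row_mx (x%:M : 'M[R]_1) y) <->
    0 <= x /\ @simplex_le d (t - x) y.
  have x0 : row_mx (x%:M : 'M[R]_1) y 0 0 = x by exact: (row_cons0 (x, y)).
  have xS i : row_mx (x%:M : 'M[R]_1) y 0 (lift 0 i) = y 0 i.
    exact: (row_consS (x, y)).
  rewrite /simplex_le /= big_ord_recl x0 (eq_bigr _ (fun i _ => xS i)) lerBrDl.
  split=> [[h hs]|[? [h ?]]].
    by split; [rewrite -x0|split=> // i; rewrite -xS].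
  split=> // i; case: (unliftP ord0 i) => [j|] ->; rewrite ?x0// xS; exact: h.
case: ifPn => [/set_mem|]; last rewrite notin_setE; rewrite /= in_itv /=.
  move=> /andP[x0 xt]; rewrite -[RHS]IH ?subr_ge0//; congr (leb R d _).
  by apply/seteqP; split=> y; rewrite /= rowE; [case|split].
move=> h; rewrite (_ : [set y | _] = set0) ?measure0//.
apply/seteqP; split=> // y; rewrite /= rowE => -[x0 [y0 ys]]; apply: h.
rewrite x0 -subr_ge0; apply: le_trans ys.
by apply: sumr_ge0 => i _; exact: y0.
Qed.
End Simplex.

(** * Volumes of parallelepipeds and simplices *)

Section Volumes.
Variable R : realType.

Lemma dotv_mulmx k (u v : 'rV[R]_k) : dotv u v = (u *m v^T) 0 0.
Proof. by rewrite mxE; apply: eq_bigr => i _; rewrite mxE. Qed.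

Lemma dotv_gt0 k (v : 'rV[R]_k) : v != 0 -> 0 < dotv v v.
Proof.
move=> /rV0Pn[i vi].
rewrite /dotv (bigD1 i)//= ltr_pwDl//; first by rewrite -expr2 exprn_even_gt0//= vi.
by apply: sumr_ge0 => j _; rewrite -expr2 sqr_ge0.
Qed.

(** Gram-Schmidt: the first row, minus its projection onto the span of the others, is normalized and
    put on top of their basis. *)
Lemma orthonormal_basis d k (P : 'M[R]_(d, k)) : row_free P ->
  exists2 B : 'M[R]_(d, k), B *m B^T = 1%:M & (P <= B)%MS.
Proof.
elim: d P => [|d IH]; last rewrite -[d.+1]/(1 + d)%N; move=> P freeP.
  by exists 0; [apply/matrixP => -[]|rewrite [P]flatmx0 sub0mx].
pose P1 : 'rV_k := usubmx P.
pose P2 : 'M[R]_(d, k) := dsubmx P.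
have PE : P = col_mx P1 P2 by rewrite vsubmxK.
have [|B BB PB] := IH P2.
  rewrite -row_leq_rank -(leq_add2l 1).
  rewrite -[leqLHS](eqP freeP) {1}PE.
  rewrite -addsmxE.
  by apply: (leq_trans (mxrank_adds_leqif _ _)); rewrite leq_add2r rank_leq_row.
pose v := P1 - P1 *m B^T *m B.
have vB : v *m B^T = 0 by rewrite mulmxBl -!mulmxA BB mulmx1 subrr.
have v0 : v != 0.
  (* Otherwise all d + 1 rows of [P] would lie in the span of the d rows of [B]. *)
  apply: contraTneq freeP => /eqP; rewrite subr_eq0 => /eqP P1E.
  rewrite -row_leq_rank -ltnNge ltnS.
  apply: (@leq_trans (\rank B)); last exact: rank_leq_row.
  by rewrite PE mxrankS// col_mx_sub PB P1E submxMl.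
have P1E : P1 = v + P1 *m B^T *m B by rewrite subrK.
clearbody v.
have Bv : B *m v^T = 0.
  by apply: trmx_inj; rewrite trmx_mul trmxK vB trmx0.
have vv := dotv_gt0 v0.
have vvT : v *m v^T = (dotv v v)%:M.
  by rewrite [LHS]mx11_scalar dotv_mulmx.
pose l := enorm v.
have l0 : 0 < l by rewrite sqrtr_gt0.
have l2 : l ^+ 2 = dotv v v by rewrite sqr_sqrtr// ltW.
exists (col_mx (l^-1 *: v) B).
  rewrite tr_col_mx mul_col_row linearZ /= -!scalemxAr -!scalemxAl BB vvT vB Bv.
  rewrite !scaler0 -l2 scalerA scale_scalar_mx -invfM -expr2.
  by rewrite mulVf ?sqrf_eq0 ?gt_eqF// -scalar_mx_block.
rewrite PE col_mx_sub; apply/andP; split; last first.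
  by rewrite (submx_trans PB)// -addsmxE addsmxSr.
have -> : P1 = l *: (l^-1 *: v) + P1 *m B^T *m B.
  by rewrite scalerA mulfV ?gt_eqF// scale1r.
rewrite -addsmxE addmx_sub//.
  by rewrite scalemx_sub// addsmxSl.
by rewrite (submx_trans (submxMl _ _))// addsmxSr.
Qed.

Lemma gram_det d k (X : 'M[R]_d) (B : 'M[R]_(d, k)) : B *m B^T = 1%:M ->
  \det (X *m B *m (X *m B)^T) = \det X ^+ 2.
Proof.
move=> BB; rewrite trmx_mul mulmxA -(mulmxA X) BB mulmx1.
by rewrite det_mulmx det_tr expr2.
Qed.

Lemma row_free_unit_factor d k (X : 'M[R]_d) (B : 'M[R]_(d, k)) :
  row_free (X *m B) -> X \in unitmx.
Proof.
rewrite -row_leq_rank -row_free_unit -row_leq_rank => h.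
by apply: leq_trans h _; rewrite mxrankM_maxl.
Qed.

Lemma gram_det_gt0 d k (P : 'M[R]_(d, k)) : row_free P ->
  0 < \det (P *m P^T).
Proof.
move=> freeP; have [B BB /submxP[X PE]] := orthonormal_basis freeP.
rewrite PE gram_det// exprn_even_gt0//= -unitfE -unitmxE.
by apply: (@row_free_unit_factor _ _ _ B); rewrite -PE.
Qed.

Lemma leb_affine_preimage d (X : 'M[R]_d) (x0 : 'rV[R]_d)
    (A : set (row_sigma R d)) : X \in unitmx -> measurable A ->
  leb R d [set x | A ((x - x0) *m invmx X)] = (`|\det X|%:E * leb R d A)%E.
Proof.
move=> uX mA.
have uX' : invmx X \in unitmx by rewrite unitmx_inv.
have := @leb_translate R d (- x0) [set y | A (y *m invmx X)].
move=> ->; last first.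
  by have := measurable_rowM (invmx X) measurableT mA; rewrite setTI.
by rewrite lebesgue_scales_unitmx// det_inv normfV invrK.
Qed.

(** The chart in [vol] is chosen by [xget], so volumes have to be computed in an unknown chart; the
    existence of one chart ensures that the chosen value is one. *)
Lemma volE d k (S : set 'rV[R]_k) :
  (exists c, isometric_chart (d := d) S c) ->
  exists2 c, isometric_chart S c &
    vol d S = fine (leb R d [set x | S (c.1 + x *m c.2)]).
Proof.
move=> [c0 hc0].
pose D := [set c | isometric_chart (d := d) S c].
exists (xget (0, 0) D); first exact: (xgetPex (0, 0) (ex_intro D c0 hc0)).
by rewrite lebE.
Qed.

Lemma chart_inj d k (S : set 'rV[R]_k) c : isometric_chart (d := d) S c ->
  injective (fun x : 'rV[R]_d => c.1 + x *m c.2).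
Proof.
move=> [BB _] x y /addrI/(congr1 (mulmx^~ c.2^T)).
by rewrite -!mulmxA BB !mulmx1.
Qed.

(** A chart of full dimension has an orthogonal matrix [B], with |det B| = 1, and in it the set is
    an affine image of the unit cube with linear part E B^-1. *)
Lemma vol_parallelepiped k (E : 'M[R]_k) : E \in unitmx ->
  vol k (parallelepiped (fun i => row i E)) = `|\det E|.
Proof.
move=> uE; set S := parallelepiped _.
have SE z : S z <-> box (fun=> `[0, 1]%classic) (z *m invmx E : row_sigma R k).
  split=> [[a a01 ->]|h].
    have -> : \sum_i a i *: row i E = (\row_i a i) *m E.
      by rewrite mulmx_sum_row; apply: eq_bigr => i _; rewrite mxE.
    by move=> i; rewrite mulmxK//= mxE in_itv; exact: a01.
  exists (fun i => (z *m invmx E) 0 i); first by move=> i; have := h i; rewrite /= in_itv.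
  by rewrite -mulmx_sum_row mulmxKV.
have [|[a B] [/= BB _] ->] := @volE k k S.
  exists (0, 1%:M); split=> [|x _]; first by rewrite trmx1 mulmx1.
  by exists x => //=; rewrite add0r mulmx1.
have uB : B \in unitmx by case/mulmx1_unit: BB.
have dB : `|\det B| = 1.
  apply/eqP; rewrite -sqrp_eq1// -normrX ger0_norm ?sqr_ge0//.
  by rewrite expr2 -{2}det_tr -det_mulmx BB det1.
rewrite (_ : [set x | _] = [set x | box (fun=> `[0, 1]%classic)
    ((x - (- (a *m invmx B))) *m invmx (E *m invmx B) : row_sigma R k)]).
  rewrite leb_affine_preimage ?unitmx_mul ?unitmx_inv ?uE//; last first.
    exact: measurable_box.
  rewrite leb_box// big1 ?mule1 => [|i _].
    by rewrite /= det_mulmx det_inv normrM normfV dB invr1 mulr1.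
  by rewrite lebesgue_measure_itv/= lte_fin ltr01 oppr0 adde0.
have -> : invmx (E *m invmx B) = B *m invmx E.
  have uX : E *m invmx B \in unitmx by rewrite unitmx_mul uE unitmx_inv.
  have XE : E *m invmx B *m (B *m invmx E) = 1%:M.
    by rewrite mulmxA mulmxKV// mulmxV.
  by rewrite -[RHS](mulKmx uX) XE mulmx1.
apply/funext => x; apply/propext; rewrite /= SE opprK mulmxA.
by rewrite [(x + _) *m B]mulmxDl mulmxKV// addrC.
Qed.

Lemma measurable_simplex_le d (t : R) : measurable (@simplex_le R d t).
Proof.
rewrite (_ : simplex_le t = box (fun=> `[0, +oo[%classic : set (measurableTypeR R))
    `&` (fun x : row_sigma R d => \sum_i x 0 i) @^-1` `]-oo, t]%classic); last first.
  apply/seteqP; split=> x /= [h1 h2]; split=> //.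
  - by move=> i; rewrite /= in_itv/= andbT.
  - by move=> i; have := h1 i; rewrite /= in_itv/= andbT.
apply: measurableI; first exact: measurable_box.
rewrite -[X in measurable X]setTI.
by apply: measurable_sum => // i; exact: measurable_coord.
Qed.

(** In any chart the edge matrix factors as [P = X *m B] with [X] square and [B] orthonormal; the
    set is then an affine image of the standard simplex, and |det X| is the root of the Gram
    determinant of [P]. *)
Lemma vol_simplex d k (p : 'rV[R]_k) (P : 'M[R]_(d, k)) : row_free P ->
  vol d [set p + y *m P | y in simplex_le 1] =
  Num.sqrt (\det (P *m P^T)) / d`!%:R.
Proof.
move=> freeP; set S := [set _ | _ in _].
have [|[a B] chart ->] := @volE d k S.
  have [B BB /submxP[X PE]] := orthonormal_basis freeP.
  exists (p, B); split=> //= _ [y _ <-].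
  by exists (y *m X); rewrite // PE mulmxA.
have /= cinj := chart_inj chart; have [/= BB SB] := chart.
have simplex0 : @simplex_le R d 1 0.
  split=> [i|]; first by rewrite mxE.
  by rewrite big1// => i _; rewrite mxE.
have simplexd i : @simplex_le R d 1 (delta_mx 0 i).
  split=> [j|]; first by rewrite mxE.
  rewrite (bigD1 i)//= big1 ?addr0; first by rewrite mxE !eqxx.
  by move=> j /negPf ji; rewrite mxE ji andbF.
have [x1 _ x1E] := SB _ (imageP (fun y => p + y *m P) simplex0).
rewrite mul0mx addr0 in x1E.
(* The chart coordinates of the vertices of the simplex are [x1] and the [x_ i]; the rows of [X] are
   their differences. *)
pose x_ i := projT1 (cid2 (SB _ (imageP (fun y => p + y *m P) (simplexd i)))).
have x_E i : a + x_ i *m B = p + row i P.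
  by rewrite /x_; case: cid2 => x /= _ ->; rewrite -rowE.
pose X : 'M[R]_d := \matrix_i (x_ i - x1).
have PE : P = X *m B.
  apply/row_matrixP => i; rewrite row_mul rowK mulmxBl.
  apply: (addrI p); rewrite -x_E -x1E -addrA; congr (_ + _).
  by rewrite addrC subrK.
have uX : X \in unitmx by apply: (@row_free_unit_factor _ _ _ B); rewrite -PE.
rewrite (_ : [set x | _] = [set x | simplex_le 1
    ((x - x1) *m invmx X : row_sigma R d)]); last first.
  apply/seteqP; split=> x /=.
    move=> [y ys]; rewrite -x1E PE mulmxA -addrA -mulmxDl => /cinj <-.
    by rewrite addrAC subrr add0r mulmxK.
  exists ((x - x1) *m invmx X) => //.
  by rewrite PE mulmxA mulmxKV// -x1E -addrA -mulmxDl [x1 + _]addrC subrK.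
rewrite leb_affine_preimage//; last exact: measurable_simplex_le.
by rewrite leb_simplex_le//= expr1n mul1r PE gram_det// sqrtr_sqr.
Qed.
End Volumes.

(** * Vertices and edges of polytopes *)

Section DotProduct.
Variables (R : realType) (k : nat).
Implicit Types u v g d e : 'rV[R]_k.

Lemma dotvC u v : dotv u v = dotv v u.
Proof. by apply: eq_bigr => i _; rewrite mulrC. Qed.

Fact dotv_is_linear u : linear_for *%R (dotv u).
Proof.
move=> a v e; rewrite /dotv mulr_sumr -big_split; apply: eq_bigr => i _ /=.
by rewrite !mxE mulrDr mulrCA.
Qed.

HB.instance Definition _ u :=
  GRing.isLinear.Build R 'rV[R]_k R *%R (dotv u) (dotv_is_linear u).

Lemma dotv0r u : dotv u 0 = 0.
Proof. exact: linear0. Qed.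

Lemma dotvZr a u v : dotv u (a *: v) = a * dotv u v.
Proof. exact: linearZ. Qed.

Lemma dotvDr u v e : dotv u (v + e) = dotv u v + dotv u e.
Proof. exact: linearD. Qed.

Lemma dotvBr u v e : dotv u (v - e) = dotv u v - dotv u e.
Proof. exact: linearB. Qed.

Lemma dotv_sumr (I : finType) (P : pred I) u (e : I -> 'rV[R]_k) :
  dotv u (\sum_(i | P i) e i) = \sum_(i | P i) dotv u (e i).
Proof. exact: linear_sum. Qed.

Lemma dotvZl a u v : dotv (a *: u) v = a * dotv u v.
Proof. by rewrite dotvC dotvZr dotvC. Qed.

Lemma dotvDl u v e : dotv (u + v) e = dotv u e + dotv v e.
Proof. by rewrite dotvC dotvDr !(dotvC e). Qed.

Lemma dotvNl u v : dotv (- u) v = - dotv u v.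
Proof. by rewrite dotvC -scaleN1r dotvZr mulN1r dotvC. Qed.

Lemma dotvBl u v e : dotv (u - v) e = dotv u e - dotv v e.
Proof. by rewrite dotvDl dotvNl. Qed.

(** The component of [e] orthogonal to [d]. This projection is self-adjoint by [dotv_reject], so a
    functional on projected vectors pulls back to one that vanishes on [d]. *)
Definition reject d e := e - (dotv d e / dotv d d) *: d.

Lemma dotv_reject d g e : dotv (reject d g) e = dotv g (reject d e).
Proof.
by rewrite /reject dotvBl dotvZl dotvBr dotvZr (dotvC g d); ring.
Qed.

Lemma reject_self d : d != 0 -> reject d d = 0.
Proof.
by move=> d0; rewrite /reject mulfV ?scale1r ?subrr// gt_eqF// dotv_gt0.
Qed.

(* Induction on the number of vectors. A vector e0 is removed and the others
   are projected onto its orthogonal complement: a solution g for the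
   projections is tilted towards e0, and a dependency between them puts a
   multiple of e0 into the cone of the other vectors. *)
Lemma gordan (T : finType) (J : {set T}) (e : T -> 'rV[R]_k) :
  (exists g, forall j, j \in J -> 0 < dotv g (e j)) \/
  (exists a : T -> R, [/\ forall j, 0 <= a j,
     exists2 j, j \in J & 0 < a j & \sum_(j in J) a j *: e j = 0]).
Proof.
have [n] := ubnP #|J|; elim: n => // n IH in J e *; rewrite ltnS => leJn.
have [->|[i0 i0J]] := set_0Vmem J.
  by left; exists 0 => j; rewrite inE.
pose J' := J :\ i0.
have ltJ : (#|J'| < n)%N by rewrite (leq_trans _ leJn)// [#|J|](cardsD1 i0) i0J.
have JJ' j : j \in J -> j != i0 -> j \in J' by move=> jJ ji; rewrite !inE ji.
have J'J j : j \in J' -> j \in J by rewrite !inE => /andP[].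
have J'i j : j \in J' -> j != i0 by rewrite !inE => /andP[].
have sumJ (a : T -> R) x :
    \sum_(j in J) (if j == i0 then x else a j) *: e j =
    x *: e i0 + \sum_(j in J') a j *: e j.
  rewrite (big_setD1 i0)//= eqxx; congr (_ + _); apply: eq_bigr => j jJ'.
  by rewrite ifN// J'i.
have extend (a : T -> R) x : (forall j, 0 <= a j) -> 0 <= x ->
    (0 < x \/ exists2 j, j \in J' & 0 < a j) ->
    x *: e i0 + \sum_(j in J') a j *: e j = 0 ->
    exists a : T -> R, [/\ forall j, 0 <= a j,
     exists2 j, j \in J & 0 < a j & \sum_(j in J) a j *: e j = 0].
  move=> a0 x0 pos eq0; exists (fun j => if j == i0 then x else a j).
  split; [by move=> j; case: ifP| |by rewrite sumJ].
  case: pos => [xp|[j jJ' aj]]; first by exists i0; rewrite // eqxx.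
  by exists j; [exact: J'J|rewrite ifN// J'i].
have [e0|e0] := eqVneq (e i0) 0.
  right; apply: (extend (fun=> 0) 1) => //; first by left.
  by rewrite e0 scaler0 add0r big1// => j _; rewrite scale0r.
have ee := dotv_gt0 e0.
have [[g gpos]|[a [a0 [j0 j0J' aj0] adep]]] := IH J' (fun j => reject (e i0) (e j)) ltJ.
  left; pose g1 := reject (e i0) g.
  have g1e : dotv g1 (e i0) = 0 by rewrite dotv_reject reject_self// dotv0r.
  have g1pos j : j \in J' -> 0 < dotv g1 (e j).
    by move=> /gpos; rewrite -dotv_reject.
  (* Large enough that N <g1, e_j> exceeds |<e_i0, e_j>| for every j in J'. *)
  pose N := 1 + \sum_(j in J') `|dotv (e i0) (e j)| / dotv g1 (e j).
  exists (N *: g1 + e i0) => j jJ; rewrite dotvDl dotvZl.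
  have [->|/(JJ' _ jJ) jJ'] := eqVneq j i0; first by rewrite g1e mulr0 add0r.
  have gj := g1pos _ jJ'.
  have Nj : 1 + `|dotv (e i0) (e j)| / dotv g1 (e j) <= N.
    rewrite lerD2l (bigD1 j)//= lerDl sumr_ge0// => l /andP[lJ' _].
    by rewrite divr_ge0// ltW// g1pos.
  have : (1 + `|dotv (e i0) (e j)| / dotv g1 (e j)) * dotv g1 (e j) <=
      N * dotv g1 (e j) by rewrite ler_pM2r.
  rewrite mulrDl mul1r divfK ?gt_eqF// => le1.
  rewrite -ltrBlDr sub0r (lt_le_trans _ le1)//.
  by rewrite (le_lt_trans (ler_norm _))// normrN ltrDr.
pose mu := \sum_(j in J') a j * (dotv (e i0) (e j) / dotv (e i0) (e i0)).
have muE : \sum_(j in J') a j *: e j = mu *: e i0.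
  rewrite scaler_suml; apply/eqP; rewrite -subr_eq0 -sumrB -[X in _ == X]adep.
  by apply/eqP/eq_bigr => j _; rewrite scalerBr scalerA.
have [mu0|mu0] := leP mu 0.
  right; apply: (extend a (- mu)) => //; first by rewrite oppr_ge0.
    by right; exists j0.
  by rewrite muE scaleNr addNr.
(* Here e_i0 is a positive multiple of a combination of the other vectors, so any g positive on
   these is positive on e_i0; the induction hypothesis is used again, without projecting. *)
have [[g gpos]|[b [b0 bpos bdep]]] := IH J' e ltJ; last first.
  right; apply: (extend b 0) => //; first by right.
  by rewrite scale0r add0r.
left; exists g => j jJ.
have [->|/(JJ' _ jJ)] := eqVneq j i0; last exact: gpos.
have : 0 < mu * dotv g (e i0).
  have <- : dotv g (\sum_(j in J') a j *: e j) = mu * dotv g (e i0).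
    by rewrite muE dotvZr.
  rewrite dotv_sumr (bigD1 j0)//= ltr_pwDl//.
    by rewrite dotvZr mulr_gt0// gpos.
  by apply: sumr_ge0 => l /andP[lJ' _]; rewrite dotvZr mulr_ge0// ltW// gpos.
by rewrite pmulr_rgt0.
Qed.

Definition cone_of (T : finType) (e : T -> 'rV[R]_k) (J : {set T}) : set 'rV[R]_k :=
  [set x | exists2 a : T -> R, forall j, 0 <= a j & x = \sum_(j in J) a j *: e j].

Lemma cone_of_gen (T : finType) (e : T -> 'rV[R]_k) (J : {set T}) j :
  j \in J -> cone_of e J (e j).
Proof.
move=> jJ; exists (fun i => (i == j)%:R) => [i|]; first by rewrite ler0n.
rewrite (bigD1 j)//= eqxx scale1r big1 ?addr0// => i /andP[_ /negPf ->].
by rewrite scale0r.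
Qed.

Lemma cone_of_sum (T I : finType) (e : T -> 'rV[R]_k) (J : {set T})
    (P : pred I) (c : I -> R) (x : I -> 'rV[R]_k) :
  (forall i, 0 <= c i) -> (forall i, P i -> cone_of e J (x i)) ->
  cone_of e J (\sum_(i | P i) c i *: x i).
Proof.
move=> c0 xC; elim/big_ind: _ => [|y z [a a0 ->] [b b0 ->]|i /xC[a a0 ->]].
- by exists (fun=> 0) => //; rewrite big1// => i _; rewrite scale0r.
- exists (fun j => a j + b j) => [j|]; first exact: addr_ge0.
  by rewrite -big_split; apply: eq_bigr => j _; rewrite scalerDl.
- exists (fun j => c i * a j) => [j|]; first exact: mulr_ge0.
  by rewrite scaler_sumr; apply: eq_bigr => j _; rewrite scalerA.
Qed.

Lemma cone_ofZ (T : finType) (e : T -> 'rV[R]_k) (J : {set T}) c x :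
  0 <= c -> cone_of e J x -> cone_of e J (c *: x).
Proof.
move=> c0 [a a0 ->]; exists (fun j => c * a j) => [j|]; first exact: mulr_ge0.
by rewrite scaler_sumr; apply: eq_bigr => j _; rewrite scalerA.
Qed.

(* If d i is not exposed within a generating family of minimal size, then
   gordan modulo d i gives a dependency between the other generators and d i;
   as h is positive, it puts d i into the cone of the others. *)
Lemma minimal_generators (T : finType) (d : T -> 'rV[R]_k) h :
  (forall i, d i != 0 -> 0 < dotv h (d i)) ->
  exists J : {set T}, (forall i, cone_of d J (d i)) /\
    forall i, i \in J -> d i != 0 /\
      exists2 g, dotv g (d i) = 0 &
        forall j, j \in J -> j != i -> 0 < dotv g (d j).
Proof.
move=> hpos; pose gen (J : {set T}) := `[< forall i, cone_of d J (d i) >].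
have genT : gen [set: T]%SET by apply/asboolP => i; apply: cone_of_gen; rewrite inE.
case: (arg_minnP (fun J : {set T} => #|J|) genT) => J /asboolP genJ minJ.
have irred i : i \in J -> ~ cone_of d (J :\ i) (d i).
  move=> iJ iJ'; have : gen (J :\ i).
    apply/asboolP => j; have [a a0 ->] := genJ j.
    apply: cone_of_sum => // l lJ; have [->//|li] := eqVneq l i.
    by apply: cone_of_gen; rewrite !inE li.
  by move=> /minJ; rewrite leqNgt [#|J|](cardsD1 i) iJ ltnS leqnn.
have nz i : i \in J -> d i != 0.
  move=> /irred iJ; apply/eqP => di0; apply: iJ; rewrite di0; exists (fun=> 0) => //.
  by rewrite big1// => l _; rewrite scale0r.
exists J; split=> // i iJ; pose J' := J :\ i; have di := nz i iJ.
split=> //.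
have [[g gpos]|[a [a0 [j jJ' aj] adep]]] := gordan J' (fun j => reject (d i) (d j)).
  exists (reject (d i) g); first by rewrite dotv_reject reject_self// dotv0r.
  by move=> j jJ ji; rewrite dotv_reject gpos// !inE ji.
exfalso; pose mu := \sum_(j in J') a j * (dotv (d i) (d j) / dotv (d i) (d i)).
have muE : \sum_(j in J') a j *: d j = mu *: d i.
  rewrite scaler_suml; apply/eqP; rewrite -subr_eq0 -sumrB -[X in _ == X]adep.
  by apply/eqP/eq_bigr => l _; rewrite scalerBr scalerA.
have hge0 l : 0 <= dotv h (d l).
  by have [->|/hpos/ltW//] := eqVneq (d l) 0; rewrite dotv0r.
have hj : 0 < dotv h (d j).
  by apply/hpos/nz; move: jJ'; rewrite !inE => /andP[].
have mu0 : 0 < mu.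
  rewrite -(pmulr_lgt0 _ (hpos i di)).
  have <- : dotv h (\sum_(j in J') a j *: d j) = mu * dotv h (d i).
    by rewrite muE dotvZr.
  rewrite dotv_sumr (bigD1 j)//= ltr_pwDl//; first by rewrite dotvZr mulr_gt0.
  by apply: sumr_ge0 => l _; rewrite dotvZr mulr_ge0.
apply: (irred i iJ); exists (fun l => mu^-1 * a l) => [l|].
  by rewrite mulr_ge0// invr_ge0 ltW.
under eq_bigr do rewrite -scalerA.
by rewrite -scaler_sumr muE scalerA mulVf ?scale1r// gt_eqF.
Qed.
End DotProduct.

Section PolytopeVertices.
Variables (R : realType) (k m : nat) (p : 'I_m -> 'rV[R]_k).
Notation Q := (conv_hull p).

Lemma conv_hull_gen i : Q (p i).
Proof.
exists (fun j => (j == i)%:R); split=> [j||]; first by rewrite ler0n.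
  by rewrite (bigD1 i)//= eqxx big1 ?addr0// => j /negPf ->.
rewrite (bigD1 i)//= eqxx scale1r big1 ?addr0// => j /negPf ->.
by rewrite scale0r.
Qed.

Lemma conv_hull_convex (t : R) x y : 0 <= t <= 1 -> Q x -> Q y ->
  Q ((1 - t) *: x + t *: y).
Proof.
move=> /andP[t0 t1] [a [a0 a1 ->]] [b [b0 b1 ->]].
exists (fun i => (1 - t) * a i + t * b i); split=> [i||].
- by apply: addr_ge0; apply: mulr_ge0; rewrite ?subr_ge0.
- by rewrite big_split/= -!mulr_sumr a1 b1; ring.
- rewrite !scaler_sumr -big_split; apply: eq_bigr => i _ /=.
  by rewrite !scalerA scalerDl.
Qed.

Lemma conv_hull_sub (a : 'I_m -> R) x : \sum_i a i = 1 ->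
  \sum_i a i *: p i - x = \sum_i a i *: (p i - x).
Proof.
move=> a1; rewrite -[X in _ - X]scale1r -a1 scaler_suml -sumrB.
by apply: eq_bigr => i _; rewrite scalerBr.
Qed.

(* Homogenization: the p i are the generators of a cone at height 1. *)
Lemma conv_vertices z : Q z -> exists a : 'I_m -> R,
  [/\ forall i, 0 <= a i, \sum_i a i = 1, z = \sum_i a i *: p i &
      forall i, a i != 0 -> vertices Q (p i)].
Proof.
pose d i : 'rV[R]_(1 + k) := row_mx 1 (p i).
have dotd g i : dotv g (d i) = g 0 0 + dotv (rsubmx g) (p i).
  rewrite /dotv big_split_ord /= big_ord1 row_mxEl mxE mulr1; congr (_ + _).
    by congr (g _ _); apply: val_inj.
  by apply: eq_bigr => j _; rewrite row_mxEr mxE.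
pose h : 'rV[R]_(1 + k) := row_mx 1 0.
have dot1 i : dotv h (d i) = 1.
  rewrite dotd row_mxKr -[dotv _ _]dotvC dotv0r addr0.
  have -> : 0 = lshift k (0 : 'I_1) by apply: val_inj.
  by rewrite row_mxEl mxE.
have [|J [genJ expJ]] := @minimal_generators R _ _ d h.
  by move=> i _; rewrite dot1.
have genQ y : Q y -> exists a : 'I_m -> R,
    [/\ forall i, 0 <= a i, \sum_i a i = 1, y = \sum_i a i *: p i &
      forall i, a i != 0 -> i \in J].
  move=> [b [b0 b1 ->]].
  have [c c0 cE] : cone_of d J (\sum_i b i *: d i).
    by apply: cone_of_sum.
  exists (fun i => if i \in J then c i else 0); split=> [i|||i].
  - by case: ifP.
  (* Pairing with [h] reads off the height, which is the sum of the coefficients. *)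
  - have := congr1 (dotv h) cE; rewrite !dotv_sumr.
    under eq_bigr do rewrite dotvZr dot1 mulr1.
    under [X in _ = X]eq_bigr do rewrite dotvZr dot1 mulr1.
    by rewrite -big_mkcond /= b1.
  - have := congr1 rsubmx cE; rewrite !linear_sum /=.
    under eq_bigr do rewrite linearZ /= row_mxKr.
    under [X in _ = X]eq_bigr do rewrite linearZ /= row_mxKr.
    move=> ->; rewrite big_mkcond; apply: eq_bigr => i _.
    by case: ifP; rewrite ?scale0r.
  - by case: ifP; rewrite ?eqxx.
have dotQ (g : 'rV_(1 + k)) (a : 'I_m -> R) : \sum_i a i = 1 ->
    g 0 0 + dotv (rsubmx g) (\sum_i a i *: p i) =
    \sum_i a i * dotv g (d i).
  move=> a1; rewrite dotv_sumr -[g 0 0]mul1r -a1 mulr_suml -big_split.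
  by apply: eq_bigr => i _ /=; rewrite dotvZr dotd mulrDr.
move=> /genQ[a [a0 a1 zE aJ]]; exists a; split=> // i /aJ/expJ[di [g gi gpos]].
have gJ l : l \in J -> 0 <= dotv g (d l).
  by have [->|li] := eqVneq l i; rewrite ?gi// => /gpos/(_ li)/ltW.
(* The functional exposing the ray of [d i], restricted to height 1, becomes a supporting hyperplane
   of the polytope at [p i]. *)
exists (- rsubmx g), (g 0 0); split=> [y|].
  move=> /genQ[b [b0 b1 -> bJ]]; rewrite dotvNl -subr_ge0 opprK dotQ// sumr_ge0//.
  move=> l _; have [->|/bJ lJ] := eqVneq (b l) 0; first by rewrite mul0r.
  by rewrite mulr_ge0// gJ.
apply/seteqP; split=> y /=.
  move=> ->; split; first exact: conv_hull_gen.
  by apply/eqP; rewrite dotvNl eq_sym -subr_eq0 opprK -dotd gi.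
move=> [/genQ[b [b0 b1 -> bJ]]] /eqP; rewrite dotvNl eq_sym -subr_eq0 opprK dotQ//.
rewrite psumr_eq0 => [/allP/= zero|l _]; last first.
  have [->|/bJ lJ] := eqVneq (b l) 0; first by rewrite mul0r.
  by rewrite mulr_ge0// gJ.
have b0' l : l != i -> b l = 0.
  move=> li; have [//|bl] := eqVneq (b l) 0; have := zero l (mem_index_enum l).
  by rewrite mulf_eq0 (negPf bl) gt_eqF//= gpos// bJ.
have bi : b i = 1 by rewrite -b1 (bigD1 i)//= big1 ?addr0// => l /b0'.
by rewrite (bigD1 i)//= bi scale1r big1 ?addr0// => l /b0' ->; rewrite scale0r.
Qed.

(** The directions p_i - x have a minimal family of generators, each spanning an exposed ray; the
    farthest p_l on such a ray is a neighbour of x. The functional exposing x provides the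
    positivity that [minimal_generators] requires. *)
Lemma edge_cone n (v : 'I_n -> 'rV[R]_k) x z :
  face Q [set x] -> neighbours Q x = range v -> Q z ->
  cone_of (fun j => v j - x) [set: 'I_n]%SET (z - x).
Proof.
move=> [c [b [cle xE]]] nbE.
have [Qx cx] : Q x /\ dotv c x = b by have : [set x] x by []; rewrite xE.
pose d i := p i - x.
have [|J [genJ expJ]] := @minimal_generators R _ _ d (- c).
  move=> i; rewrite subr_eq0 dotvNl dotvBr cx opprB subr_gt0 => pix.
  rewrite lt_neqAle cle ?andbT; last exact: conv_hull_gen.
  apply: contraNneq pix => cpi; suff : [set x] (p i) by move=> /= ->.
  by rewrite xE; split=> //; exact: conv_hull_gen.
suff edgeJ i : i \in J -> cone_of (fun j => v j - x) [set: 'I_n]%SET (d i).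
  move=> [a [a0 a1 ->]]; rewrite conv_hull_sub//.
  apply: cone_of_sum => // i _; rewrite -/(d i); have [e e0 ->] := genJ i.
  exact: cone_of_sum.
move=> iJ; have [di [g gi gpos]] := expJ i iJ.
have gJ l : l \in J -> 0 <= dotv g (d l).
  by have [->|li] := eqVneq l i; rewrite ?gi// => /gpos/(_ li)/ltW.
have gd l : 0 <= dotv g (d l).
  have [a a0 ->] := genJ l; rewrite dotv_sumr sumr_ge0// => j jJ.
  by rewrite dotvZr mulr_ge0// gJ.
(* Since g vanishes on no generator but [d i], the directions in its kernel are multiples of
   [d i]. *)
have ray l : exists2 t, 0 <= t & dotv g (d l) = 0 -> d l = t *: d i.
  have [a a0 dlE] := genJ l; exists (a i) => // /eqP.
  rewrite dlE dotv_sumr psumr_eq0 => [/allP/= zero|j jJ]; last first.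
    by rewrite dotvZr mulr_ge0// gJ.
  rewrite (bigD1 i)//= big1 ?addr0// => j /andP[jJ ji].
  have := zero j (mem_index_enum j); rewrite jJ dotvZr mulf_eq0.
  by rewrite [dotv g _ == 0]gt_eqF ?gpos// orbF => /eqP ->; rewrite scale0r.
pose t l := projT1 (cid2 (ray l)).
have t0 l : 0 <= t l by rewrite /t; case: cid2.
have tE l : dotv g (d l) = 0 -> d l = t l *: d i by rewrite /t; case: cid2.
have ti : t i = 1.
  apply/eqP; rewrite -subr_eq0 -[_ == 0]orbF -(negPf di) -scaler_eq0.
  by rewrite scalerBl scale1r -tE// subrr.
have gi' : dotv g (d i) == 0 by rewrite gi.
(* [p l] is the far end of the edge; [t i = 1] ensures that its parameter is positive. *)
have [l /eqP gl tmax] := @arg_maxP _ _ _ i (fun j => dotv g (d j) == 0) t gi'.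
have tl : 0 < t l by rewrite (lt_le_trans _ (tmax i gi'))// ti.
have plE : p l = x + t l *: d i by rewrite -tE// addrC subrK.
have nb : neighbours Q x (p l).
  split.
    by move/eqP; rewrite -subr_eq0 -oppr_eq0 opprB -/(d l) tE// scaler_eq0 (negPf di) gt_eqF.
  exists (- g), (- dotv g x); split=> [y [a [a0 a1 ->]]|].
    rewrite dotvNl lerN2 -subr_ge0 -dotvBr conv_hull_sub// dotv_sumr sumr_ge0//.
    by move=> j _; rewrite dotvZr mulr_ge0 ?a0 ?(gd j).
  apply/seteqP; split=> y /=.
    move=> [s s01 ->]; split; first exact: conv_hull_convex s01 Qx (conv_hull_gen l).
    rewrite dotvNl dotvDr !dotvZr; congr (- _).
    have -> : dotv g (p l) = dotv g x.
      by apply/eqP; rewrite -subr_eq0 -dotvBr -/(d l) gl.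
    ring.
  move=> [[a [a0 a1 yE]] /eqP].
  rewrite dotvNl eqr_opp -subr_eq0 -dotvBr yE conv_hull_sub// dotv_sumr.
  rewrite psumr_eq0 => [/allP/= zero|j _]; last first.
    by rewrite dotvZr mulr_ge0 ?a0 ?(gd j).
  have aE j : a j *: (p j - x) = (a j * t j) *: d i.
    have := zero j (mem_index_enum j); rewrite dotvZr mulf_eq0.
    case/orP => /eqP; first by move=> ->; rewrite mul0r !scale0r.
    by move=> /tE dj; rewrite -/(d j) dj scalerA.
  (* The position of y on the ray; as an average of the parameters [t j], it is at most [t l]. *)
  pose s := \sum_j a j * t j.
  have yxE : y - x = s *: d i.
    by rewrite yE conv_hull_sub// scaler_suml; apply: eq_bigr => j _; rewrite aE.
  have sl : 0 <= s <= t l.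
    apply/andP; split; first by rewrite sumr_ge0// => j _; rewrite mulr_ge0.
    rewrite -[t l]mul1r -a1 mulr_suml; apply: ler_sum => j _.
    have [->|aj] := eqVneq (a j) 0; first by rewrite !mul0r.
    apply: ler_wpM2l => //; apply: tmax.
    by have := zero j (mem_index_enum j); rewrite dotvZr mulf_eq0 (negPf aj).
  exists (s / t l).
    case/andP: sl => s0 sl; rewrite divr_ge0//=.
    by rewrite ler_pdivrMr// mul1r.
  rewrite -yE plE scalerBl scale1r scalerDr scalerA divfK ?gt_eqF// -yxE.
  by rewrite addrA subrK addrC subrK.
move: nb; rewrite nbE => -[j _ vj].
have -> : d i = (t l)^-1 *: (v j - x).
  by rewrite vj -/(d l) (tE l)// scalerA mulVf ?scale1r// gt_eqF.
apply: cone_ofZ; first by rewrite invr_ge0 ltW.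
exact: (cone_of_gen _ (finset.in_setT j)).
Qed.
End PolytopeVertices.

(** * The ridge of the polar dual *)

Lemma dotv_row (R : realType) k m n (A : 'M[R]_(m, k)) (B : 'M[R]_(n, k)) i j :
  dotv (row i A) (row j B) = (A *m B^T) i j.
Proof. by rewrite mxE; apply: eq_bigr => l _; rewrite !mxE. Qed.

Section Ridge.
Variables (R : realType) (d : nat) (x : 'rV[R]_d.+2) (E : 'M[R]_d.+2).
Variable c : 'rV[R]_d.+2.
Hypotheses (uE : E \in unitmx) (c_gt0 : forall j, 0 < c 0 j).
Hypothesis xE : x = - (c *m E).

(** Index 0 stands for the neighbour defining the ridge, [o1] for the base vertex of the simplex,
    and [o2 i] for its other vertices. *)
Let o1 : 'I_d.+2 := lift ord0 ord0.
Let o2 (i : 'I_d) : 'I_d.+2 := lift ord0 (lift ord0 i).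

(** The rows are the dual basis vectors of [E], the j-th divided by - c_j so that its product with
    [x] is 1; those with j <> 0 are the vertices of the ridge. *)
Let G : 'M[R]_d.+2 := diag_mx (\row_j - (c 0 j)^-1) *m (invmx E)^T.

Let GE j i : dotv (row j G) (row i E) = - (c 0 j)^-1 *+ (j == i).
Proof.
have : (G *m E^T) j i = - (c 0 j)^-1 *+ (j == i).
  by rewrite -mulmxA -trmx_mul mulmxV// trmx1 mulmx1 !mxE.
by rewrite -dotv_row.
Qed.

Let GE_neq j i : j != i -> dotv (row j G) (row i E) = 0.
Proof. by move=> /negPf ji; rewrite GE ji. Qed.

Let dot_x p : dotv p x = - \sum_j c 0 j * dotv p (row j E).
Proof.
rewrite xE -scaleN1r dotvZr mulN1r mulmx_sum_row dotv_sumr; congr (- _).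
by apply: eq_bigr => j _; rewrite dotvZr.
Qed.

Let Gx j : dotv (row j G) x = 1.
Proof.
rewrite dot_x (bigD1 j)//= big1 => [|i /negPf ij].
  by rewrite GE eqxx mulr1n addr0 mulrN opprK mulfV ?gt_eqF.
by rewrite GE eq_sym ij mulr0n mulr0.
Qed.

Let P : 'M[R]_(d, d.+2) := \matrix_i (row (o2 i) G - row o1 G).

Let dot_yP (y : 'rV[R]_d) z : dotv (row o1 G + y *m P) z =
  dotv (row o1 G) z + \sum_i y 0 i * (dotv (row (o2 i) G) z - dotv (row o1 G) z).
Proof.
rewrite dotvDl mulmx_sum_row; congr (_ + _); rewrite dotvC dotv_sumr.
by apply: eq_bigr => i _; rewrite dotvZr rowK dotvC dotvBl.
Qed.

Let dot_yP_x y : dotv (row o1 G + y *m P) x = 1.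
Proof.
by rewrite dot_yP Gx big1 ?addr0// => i _; rewrite Gx subrr mulr0.
Qed.

Let dot_yP0 y : dotv (row o1 G + y *m P) (row ord0 E) = 0.
Proof.
rewrite dot_yP GE_neq// big1 ?addr0// => i _.
by rewrite !GE_neq// subrr mulr0.
Qed.

Let dot_yP1 y : dotv (row o1 G + y *m P) (row o1 E) =
  - (c 0 o1)^-1 * (1 - \sum_i y 0 i).
Proof.
rewrite dot_yP GE eqxx mulr1n mulrBr mulr1 mulr_sumr -sumrN; congr (_ + _).
by apply: eq_bigr => i _; rewrite GE_neq// sub0r; ring.
Qed.

Let dot_yP2 y i : dotv (row o1 G + y *m P) (row (o2 i) E) =
  - (c 0 (o2 i))^-1 * y 0 i.
Proof.
rewrite dot_yP GE_neq// add0r (bigD1 i)//= big1 => [|l li].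
  by rewrite GE eqxx mulr1n subr0 addr0 mulrC.
by rewrite GE_neq ?subrr ?mulr0.
Qed.

(** Only the neighbours of x enter: given <p, x> = 1, the condition <p, v_j> <= 1 reads <p, v_j - x>
    <= 0. *)
Definition ridge_at : set 'rV[R]_d.+2 := [set p |
  [/\ dotv p x = 1, dotv p (row ord0 E) = 0 & forall j, dotv p (row j E) <= 0]].

Let ridge_atE : ridge_at = [set row o1 G + y *m P | y in simplex_le 1].
Proof.
apply/seteqP; split=> [p [px p0 pE]|_ [y [y0 y1] <-]]; last first.
  split=> // j; case: (unliftP ord0 j) => [i|] ->; last by rewrite dot_yP0.
  case: (unliftP ord0 i) => [l|] ->.
    by rewrite dot_yP2 mulNr oppr_le0 mulr_ge0// invr_ge0 ltW.
  by rewrite dot_yP1 mulNr oppr_le0 mulr_ge0// ?subr_ge0// invr_ge0 ltW.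
(* The barycentric coordinates of p at the vertices [o2 i]; by <p, x> = 1 the remaining one, at
   [o1], is - c_o1 <p, e_o1>. *)
pose y : 'rV_d := \row_i - (c 0 (o2 i) * dotv p (row (o2 i) E)).
have sumy : 1 - \sum_i y 0 i = - (c 0 o1 * dotv p (row o1 E)).
  rewrite -px dot_x !big_ord_recl p0 mulr0 add0r opprD -addrA.
  rewrite -[RHS]addr0; congr (_ + _); rewrite -opprD; apply/eqP; rewrite oppr_eq0.
  rewrite -big_split big1//= => i _; rewrite mxE subrr//.
exists y.
  split=> [i|]; first by rewrite mxE oppr_ge0 mulr_ge0_le0// ltW.
  by rewrite -subr_ge0 sumy oppr_ge0 mulr_ge0_le0// ltW.
(* As [E] is invertible, a point is determined by its products with the rows of [E]. *)
apply: (can_inj (mulmxK (_ : E^T \in unitmx))); first by rewrite unitmx_tr.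
apply/rowP => j.
have entry (q : 'rV_d.+2) : (q *m E^T) 0 j = dotv q (row j E).
  by rewrite -dotv_row row_id.
rewrite !entry; case: (unliftP ord0 j) => [i|] ->; last by rewrite dot_yP0.
case: (unliftP ord0 i) => [l|] ->.
  by rewrite dot_yP2 mxE mulrNN mulrA mulVf ?mul1r// gt_eqF.
by rewrite dot_yP1 sumy mulrNN mulrA mulVf ?mul1r// gt_eqF.
Qed.

Let E2 : 'M[R]_(d, d.+2) := \matrix_i row (o2 i) E.
Let W : 'M[R]_(1 + 1, d.+2) := col_mx (row ord0 E) x.
Let C := \prod_i c 0 (o2 i).

Let dotP i z :
  dotv (row i P) z = dotv (row (o2 i) G) z - dotv (row o1 G) z.
Proof. by rewrite rowK dotvBl. Qed.

Let PE2 : P *m E2^T = diag_mx (\row_i - (c 0 (o2 i))^-1).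
Proof.
apply/matrixP => i l; rewrite -dotv_row dotP rowK.
by rewrite [dotv (row o1 _) _]GE_neq// subr0 GE !mxE -(inj_eq (@lift_inj _ ord0)).
Qed.

Let PW : P *m W^T = 0.
Proof.
rewrite tr_col_mx mul_mx_row.
have -> : P *m (row ord0 E)^T = 0.
  apply/matrixP => i j; rewrite -dotv_row row_id dotP mxE.
  by rewrite !GE_neq// subrr.
suff -> : P *m x^T = 0 by rewrite row_mx0.
by apply/matrixP => i j; rewrite -dotv_row row_id dotP mxE !Gx subrr.
Qed.

Let C_gt0 : 0 < C. Proof. exact: prodr_gt0. Qed.

Let det_PE2 : `|\det (P *m E2^T)| = C^-1.
Proof.
rewrite PE2 det_diag normr_prod /C -prodfV; apply: eq_bigr => i _.
by rewrite mxE normrN gtr0_norm// invr_gt0.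
Qed.

Let free_P : row_free P.
Proof.
have uPE2 : P *m E2^T \in unitmx.
  by rewrite unitmxE unitfE -normr_gt0 det_PE2 invr_gt0.
by apply/row_freeP; exists (E2^T *m invmx (P *m E2^T)); rewrite mulmxA mulmxV.
Qed.

Let det_U : `|\det (col_mx W E2 : 'M[R]_d.+2)| = c 0 o1 * `|\det E|.
Proof.
pose c' : 'rV[R]_(1 + 1 + d) := c.
pose E' : 'M[R]_(1 + 1 + d) := E.
(* The identity matrix with its second row replaced by - c, which expresses [x] in the rows of [E];
   its determinant is - c_o1. *)
pose T : 'M[R]_(1 + 1 + d) := block_mx
  (block_mx 1%:M 0 (- lsubmx (lsubmx c')) (- rsubmx (lsubmx c')))
  (col_mx 0 (- rsubmx c')) 0 1%:M.
have TE : (col_mx W E2 : 'M[R]_(1 + 1 + d)) = T *m E'.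
  have E2E : E2 = dsubmx E'.
    by apply/matrixP => i j; rewrite !mxE; congr (E _ _); apply: val_inj.
  have e0E : row ord0 E = usubmx (usubmx E').
    by apply/matrixP => i j; rewrite !mxE; congr (E _ _); apply: val_inj; rewrite /= ord1.
  rewrite -[E']vsubmxK mul_block_col -[usubmx E']vsubmxK mul_block_col mul_col_mx.
  rewrite !mul1mx !mul0mx addr0 add0r add_col_mx addr0 /W e0E E2E.
  congr (col_mx (col_mx _ _) _).
  have -> : x = - (c' *m E') by rewrite xE.
  rewrite -{1}[c']hsubmxK -{1}[lsubmx c']hsubmxK -{1}[E']vsubmxK -{1}[usubmx E']vsubmxK.
  by rewrite !mul_row_col !mulNmx !opprD.
have detT : \det T = - c 0 o1.
  rewrite det_ublock det1 mulr1 det_lblock det1 mul1r det_mx11 !mxE.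
  by congr (- c 0 _); apply: val_inj.
have -> : \det (col_mx W E2 : 'M[R]_d.+2) = \det T * \det E.
  by rewrite -[RHS](det_mulmx T E'); congr (\det _).
by rewrite detT normrM normrN (gtr0_norm (c_gt0 o1)).
Qed.

Let gram_pos : 0 < \det (W *m W^T).
Proof.
apply: gram_det_gt0.
have rU : \rank (col_mx W E2) = (1 + 1 + d)%N.
  have uU : (col_mx W E2 : 'M[R]_d.+2) \in unitmx.
    by rewrite unitmxE unitfE -normr_gt0 det_U mulr_gt0// normr_gt0 -unitfE -unitmxE.
  by apply/eqP; rewrite -row_free_unit in uU.
rewrite -row_leq_rank -(leq_add2r d) -{1}rU -addsmxE.
by rewrite (leq_trans (mxrank_adds_leqif _ _))// leq_add2l rank_leq_row.
Qed.

(** As W P^T = 0, the product U N^T is block triangular and N N^T block diagonal, so |det U| |det N|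
    = g / C and |det N|^2 = g h; with |det U| = c_o1 |det E| this gives sqrt h / sqrt g. *)
Lemma vol_ridge_at :
  vol d ridge_at / Num.sqrt (\det (W *m W^T)) =
  (d`!%:R)^-1 * ((\prod_(j | j != ord0) c 0 j)^-1 / `|\det E|).
Proof.
rewrite ridge_atE vol_simplex//.
set g := \det (W *m W^T); set h := \det (P *m P^T).
have g0 : 0 < g := gram_pos.
pose U : 'M[R]_(1 + 1 + d) := col_mx W E2.
pose N : 'M[R]_(1 + 1 + d) := col_mx W P.
have WP : W *m P^T = 0 by apply: trmx_inj; rewrite trmx_mul trmxK PW trmx0.
have UN : `|\det U| * `|\det N| = g / C.
  rewrite -normrM -[\det N]det_tr -det_mulmx tr_col_mx mul_col_row WP det_lblock.
  rewrite normrM (gtr0_norm g0); congr (_ * _).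
  by rewrite -det_PE2 -[in RHS]det_tr trmx_mul trmxK.
have NN : `|\det N| = Num.sqrt g * Num.sqrt h.
  rewrite -sqrtrM ?ltW// -sqrtr_sqr expr2 -{2}[\det N]det_tr -det_mulmx.
  by rewrite tr_col_mx mul_col_row WP PW det_lblock.
have D0 : 0 < `|\det E| by rewrite normr_gt0 -unitfE -unitmxE.
have sg : 0 < Num.sqrt g by rewrite sqrtr_gt0.
have gg : g = Num.sqrt g * Num.sqrt g by rewrite -expr2 sqr_sqrtr// ltW.
have prodE : \prod_(j | j != ord0) c 0 j = c 0 o1 * C.
  by rewrite big_mkcond !big_ord_recl /= mul1r.
have f0 : d`!%:R != 0 :> R by rewrite pnatr_eq0 -lt0n fact_gt0.
have c1 := c_gt0 o1; have C0 := C_gt0.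
suff -> : Num.sqrt h = Num.sqrt g / (c 0 o1 * C * `|\det E|).
  by rewrite prodE; field; rewrite f0 !gt_eqF.
have K0 : c 0 o1 * `|\det E| * Num.sqrt g != 0 by rewrite !mulf_neq0 ?gt_eqF.
apply: (mulfI K0); transitivity (g / C); first by rewrite -UN NN det_U; ring.
by rewrite [in LHS]gg; field; rewrite !gt_eqF.
Qed.
End Ridge.

(** * Dihedral angles and Gram determinants of two vectors *)

Lemma sin_dihedral_angle (R : realType) k (u v : 'rV[R]_k) :
  u != 0 -> v != 0 ->
  enorm u * enorm v * sin (dihedral_angle u v) =
  Num.sqrt (dotv u u * dotv v v - dotv u v ^+ 2).
Proof.
move=> u0 v0; rewrite /dihedral_angle.
have uu := dotv_gt0 u0; have vv := dotv_gt0 v0.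
set l := enorm u * enorm v; set y := dotv u v / l.
have l0 : 0 < l by rewrite mulr_gt0// sqrtr_gt0.
have l2 : l ^+ 2 = dotv u u * dotv v v by rewrite exprMn !sqr_sqrtr// ltW.
(* Cauchy-Schwarz, from the square of the component of v orthogonal to u. *)
have cs : dotv u v ^+ 2 <= l ^+ 2.
  rewrite -subr_ge0 l2; have : 0 <= dotv (reject u v) (reject u v).
    by have [->|/dotv_gt0/ltW//] := eqVneq (reject u v) 0; rewrite dotv0r.
  rewrite /reject dotvBl dotvZl !dotvBr !dotvZr (dotvC v u).
  rewrite -(ler_pM2r uu) mul0r.
  by congr (0 <= _); field; rewrite gt_eqF.
have y1 : -1 <= y <= 1.
  rewrite -ler_norml -(@ler_pXn2r _ 2)// ?nnegrE// expr1n real_normK ?num_real//.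
  by rewrite exprMn exprVn ler_pdivrMr ?exprn_gt0// mul1r.
(* The interior angle pi - acos y is acos (- y), with sine sqrt (1 - y^2). *)
rewrite -acosN// sin_acos; last by case/andP: y1 => ? ?; apply/andP; split; lra.
rewrite sqrrN -l2 -{1}[l]ger0_norm ?ltW// -sqrtr_sqr -sqrtrM ?sqr_ge0//.
by congr Num.sqrt; rewrite /y; field; rewrite gt_eqF.
Qed.

Lemma det_mx2 (R : comNzRingType) (A : 'M[R]_2) :
  \det A = A 0 0 * A 1 1 - A 0 1 * A 1 0.
Proof.
rewrite (expand_det_row _ 0) !big_ord_recl big_ord0 addr0 /cofactor !det_mx11.
rewrite !mxE /= expr0 expr1 mul1r mulN1r mulrN.
by congr (_ * A _ _ - A _ _ * A _ _); apply: val_inj.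
Qed.

Lemma gram_det2 (R : realType) k (a b : 'rV[R]_k) :
  \det (col_mx a b *m (col_mx a b)^T) = dotv a a * dotv b b - dotv a b ^+ 2.
Proof.
rewrite (@det_mx2 _ (_ *m _)) -!dotv_row.
have row0 : row (0 : 'I_2) (col_mx a b) = a.
  by rewrite -[RHS](row_id 0) -(rowKu 0 a b); congr row; apply: val_inj.
have row1 : row (1 : 'I_2) (col_mx a b) = b.
  by rewrite -[RHS](row_id 0) -(rowKd 0 a b); congr row; apply: val_inj.
by rewrite !row0 !row1 (dotvC b a) expr2.
Qed.

(** * Vertices of a polytope with the origin in its interior *)

Lemma interior_ray (R : realType) k (Q : set 'rV[R]_k) (u : 'rV[R]_k) :
  interior Q 0 -> exists2 e, 0 < e & Q (e *: u).
Proof.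
move=> /nbhs_ballP[e /= e0 eQ].
(* Balls are those of the sup norm, and [l] exceeds every |u_j|. *)
pose l := 1 + \sum_j `|u 0 j|.
have l0 : 0 < l by rewrite ltr_pwDl// sumr_ge0.
exists (e / l); first by rewrite divr_gt0.
apply: eQ; split=> // i j; rewrite /ball /= !mxE (ord1 i) sub0r normrN.
rewrite normrM gtr0_norm ?divr_gt0// mulrAC ltr_pdivrMr// ltr_pM2l//.
by rewrite /l (bigD1 j)//= addrCA ltrDl ltr_pwDl// sumr_ge0.
Qed.

(** If 0 were exposed by c, a small positive multiple of c in Q would force c = 0, and then the face
    would be all of Q, which contains nonzero points. *)
Lemma interior_vertex_neq0 (R : realType) k (Q : set 'rV[R]_k.+1) x :
  interior Q 0 -> face Q [set x] -> x != 0.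
Proof.
move=> Q0 [c [b [cle xE]]]; apply/eqP => x0.
have [_ cx] : Q x /\ dotv c x = b by have : [set x] x by []; rewrite xE.
have c0 : c = 0.
  have [e e0 /cle] := interior_ray c Q0; rewrite -cx x0 dotv0r dotvZr.
  rewrite pmulr_rle0// => cc; apply/eqP; apply: contraTT cc => /dotv_gt0.
  by rewrite -ltNge.
have [e e0 Qe] := interior_ray (const_mx 1) Q0.
have : [set x] (e *: const_mx 1).
  by rewrite xE; split=> //; rewrite -cx c0 dotvC dotv0r dotvC dotv0r.
move=> /= /rowP/(_ 0); rewrite x0 !mxE mulr1 => e00.
by rewrite e00 ltxx in e0.
Qed.

Section SimpleVertex.
Variables (R : realType) (k m : nat) (p : 'I_m -> 'rV[R]_k).
Variables (x : 'rV[R]_k) (v : 'I_k -> 'rV[R]_k).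
Notation Q := (conv_hull p).
Hypotheses (Q0 : interior Q 0) (face_x : face Q [set x]).
Hypothesis nb_x : neighbours Q x = range v.
Let E : 'M[R]_k := \matrix_j (v j - x).

Let coneE z : Q z -> exists2 a : 'rV[R]_k, (forall j, 0 <= a 0 j) & z - x = a *m E.
Proof.
move=> /(edge_cone face_x nb_x)[a a0 ->]; exists (\row_j a j).
  by move=> j; rewrite mxE.
rewrite mulmx_sum_row; apply: eq_big => j; first by rewrite finset.in_setT.
by rewrite rowK mxE.
Qed.

(** The k rows of [E] span: a small multiple of any vector is a difference of two points of Q, and z
    - x is in the row space for every z in Q. *)
Lemma simple_vertex_unitmx : E \in unitmx.
Proof.
rewrite -row_full_unit -sub1mx; apply/row_subP => i.
set u := row i 1%:M.
have [e e0 /coneE[a _ aE]] := interior_ray u Q0.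
have [b _ bE] := coneE (interior_subset Q0).
have -> : u = (e^-1 *: (a - b)) *m E.
  rewrite -scalemxAl mulmxBl -aE -bE opprB addrA subrK subr0.
  by rewrite scalerA mulVf ?scale1r// gt_eqF.
exact: submxMl.
Qed.

(** A short move from 0 along - e_j stays in Q, hence in the cone at x; so - x is e_j times a
    positive number plus a nonnegative combination of the edge vectors. *)
Lemma simple_vertex_coef_gt0 j : 0 < ((- x) *m invmx E) 0 j.
Proof.
have uE := simple_vertex_unitmx.
have [e e0 /coneE[a a0 aE]] := interior_ray (- row j E) Q0.
have -> : - x = a *m E + e *: row j E by rewrite -aE scalerN addrAC addNr add0r.
rewrite mulmxDl mulmxK// -scalemxAl -row_mul mulmxV//.
by rewrite !mxE eqxx mulr1 ltr_wpDl.
Qed.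
End SimpleVertex.

(** * The formula for the matrix entry *)

Lemma vol_ridge (R : realType) d (x : 'rV[R]_d.+2) (E : 'M[R]_d.+2) (c : 'rV[R]_d.+2)
    (r : 'I_d.+2) :
  E \in unitmx -> (forall j, 0 < c 0 j) -> x = - (c *m E) ->
  vol d [set p | [/\ dotv p x = 1, dotv p (row r E) = 0 &
                     forall j, dotv p (row j E) <= 0]] /
  Num.sqrt (dotv (row r E) (row r E) * dotv x x - dotv (row r E) x ^+ 2) =
  (d`!%:R)^-1 * ((\prod_(j | j != r) c 0 j)^-1 / `|\det E|).
Proof.
(* The transposition moves r to index 0, where [vol_ridge_at] applies. *)
move=> uE c_gt0 xE; pose s := tperm ord0 r.
pose E' := row_perm s E; pose c' := col_perm s c.
have rE j : row j E' = row (s j) E by apply/rowP => i; rewrite !mxE.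
have uE' : E' \in unitmx by rewrite /E' row_permE unitmx_mul unitmx_perm.
have xE' : x = - (c' *m E').
  rewrite [c' in RHS]col_permE [E']row_permE -mulmxA (mulmxA (perm_mx _)).
  by rewrite -perm_mxM mulVg perm_mx1 mul1mx.
have c'_gt0 j : 0 < c' 0 j by rewrite mxE.
have := vol_ridge_at uE' c'_gt0 xE'.
rewrite gram_det2 rE tpermL.
have -> : `|\det E'| = `|\det E|.
  by rewrite /E' row_permE det_mulmx det_perm normrM normrX normrN1 expr1n mul1r.
have -> : \prod_(j | j != ord0) c' 0 j = \prod_(j | j != r) c 0 j.
  rewrite [RHS](reindex_inj (@perm_inj _ s)); apply: eq_big => j; last by rewrite mxE.
  by rewrite -(inj_eq (@perm_inj _ s) j) tpermL.
move=> <-; congr (vol d _ / _); apply/seteqP; split=> p [px pr pE].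
  by split; rewrite ?rE ?tpermL// => j; rewrite rE.
split=> // [|j]; first by move: pr; rewrite rE tpermL.
by have := pE (s j); rewrite rE tpermK.
Qed.

(** The q_j form the dual basis up to sign and the factor det. For l = j the rows are a permutation
    of the e_i, of sign lost in the absolute value; otherwise two rows coincide. *)
Lemma dotv_cross_lift (R : realType) d (e : 'I_d.+1 -> 'rV[R]_d.+1) (l j : 'I_d.+1) :
  `|dotv (e l) (@cross R d.+1 (fun i => e (lift j i)))| =
  `|\det (\matrix_i e i)| *+ (l == j).
Proof.
rewrite dotv_cross//; set u := fun i => _; set A := rows_mx _.
have A0 : row ord0 A = e l by rewrite rowK.
have AS i : row (lift ord0 i) A = e (lift j i).
  rewrite rowK /= codomE (nth_map i) ?size_enum_ord ?add0n ?ltn_ord//.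
  by rewrite (@nth_ord_enum d i i).
case: (eqVneq l j) => [lj|lj]; rewrite ?mulr1n ?mulr0n.
  have -> : A = row_perm (lift_perm ord0 j 1) (\matrix_i e i).
    apply/row_matrixP => i; case: (unliftP ord0 i) => [i'|] ->; apply/rowP => h.
      by rewrite AS !mxE lift_perm_lift perm1.
    by rewrite A0 !mxE lift_perm_id lj.
  by rewrite row_permE det_mulmx det_perm normrM normrX normrN1 expr1n mul1r.
have [i il] : exists i, lift j i = l.
  by case: (unliftP j l) lj => [i ->|->]; [exists i|rewrite eqxx].
rewrite (@determinant_alternate _ _ _ ord0 (lift ord0 i)) ?normr0// => h.
by have /rowP/(_ h) := A0; have /rowP/(_ h) := AS i; rewrite !mxE il => -> ->.
Qed.

Theorem corollary1p10 (R : realType) (k n : nat) (Q : set 'rV[R]_k)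
    (w : 'I_n -> 'rV[R]_k) (s t : 'I_n) (v : 'I_k -> 'rV[R]_k) (r : 'I_k) :
  (2 <= k)%N ->
  polytope k Q ->
  injective w -> vertices Q = range w ->
  interior Q 0 ->
  simple_polytope Q w ->
  edge Q (w s) (w t) ->
  injective v -> neighbours Q (w s) = range v ->
  v r = w t ->
  let eps := fun j : 'I_k => v j - w s in
  let q := fun j : 'I_k =>
    (-1) ^+ j *: cross (fun i : 'I_k.-1 => eps (lift j i)) in
  izmestiev_mx Q w s t =
    - ((k - 2)`!%:R^-1 *
       (vol k (parallelepiped eps) ^+ (k - 2) /
        \prod_(j < k | j != r) `|dotv (w s) (q j)|)).
Proof.
case: k Q w v r => [|[|d]]// Q w v r _ [[m [p ->]] _] _ vertw Q0 _ st _ nbv vr eps q.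
have vertQ u : vertices (conv_hull p) (w u) by rewrite vertw.
have face_s := vertQ s.
pose E : 'M[R]_d.+2 := \matrix_j eps j.
have uE : E \in unitmx := simple_vertex_unitmx Q0 face_s nbv.
pose c := - w s *m invmx E.
have c_gt0 j : 0 < c 0 j := simple_vertex_coef_gt0 Q0 face_s nbv j.
have xE : w s = - (c *m E) by rewrite mulmxKV// opprK.
have D0 : 0 < `|\det E| by rewrite normr_gt0 -unitfE -unitmxE.
have nst : s == t = false by apply/eqP => e; case: st; rewrite e.
have subn2d : (d.+2 - 2)%N = d by rewrite subn2.
have ridgeE : ridge w s t = [set p | [/\ dotv p (w s) = 1,
    dotv p (row r E) = 0 & forall j, dotv p (row j E) <= 0]].
  apply/seteqP; split=> z.
    move=> [[zpol zs] [_ zt]]; split=> // [|j]; rewrite rowK dotvBr zs.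
      by rewrite vr zt subrr.
    rewrite subr_le0.
    have Qv : conv_hull p (v j).
      have [_ [g [b [_ segE]]]] : neighbours (conv_hull p) (w s) (v j) by rewrite nbv.
      have : segment (w s) (v j) (v j).
        by exists 1; [rewrite ler01 lexx|rewrite subrr scale0r add0r scale1r].
      by rewrite segE => -[].
    (* The dual is cut out by the vertices [w u], so the bound at v_j comes from writing v_j as a
       convex combination of vertices. *)
    have [a [a0 a1 -> aw]] := conv_vertices Qv.
    rewrite -a1 dotv_sumr; apply: ler_sum => i _; rewrite dotvZr.
    have [->|/aw] := eqVneq (a i) 0; first by rewrite mul0r.
    by rewrite vertw => -[u _ <-]; rewrite ler_piMr.
  move=> [zs zr zE].
  have zpol : polar_dual w z.
    move=> u; have Qwu : conv_hull p (w u).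
      have [g [b [_ wE]]] := vertQ u.
      by have : [set w u] (w u) by []; rewrite wE => -[].
    (* Conversely, [w u] lies in the cone at [w s], so the inequalities for the edge vectors imply
       the one for [w u]. *)
    have [a a0 aE] := edge_cone face_s nbv Qwu.
    rewrite -zs -subr_le0 -dotvBr aE dotv_sumr -oppr_ge0 -sumrN sumr_ge0// => j _.
    by have := zE j; rewrite rowK dotvZr -mulrN => zj; rewrite mulr_ge0// oppr_ge0.
  split; split=> //; apply/eqP.
  by rewrite -zs -subr_eq0 -dotvBr -vr -[v r - _]/(eps r) -(rowK eps) zr.
rewrite /izmestiev_mx mxE nst /izmestiev_offdiag ifT; last exact/asboolP.
(* The Gram determinant is unchanged when [w t] is replaced by the edge vector [w t - w s]. *)
have gramE : dotv (w s) (w s) * dotv (w t) (w t) - dotv (w s) (w t) ^+ 2 =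
    dotv (row r E) (row r E) * dotv (w s) (w s) - dotv (row r E) (w s) ^+ 2.
  rewrite rowK /eps vr !dotvBl !dotvBr (dotvC (w t) (w s)); ring.
have ws0 := interior_vertex_neq0 Q0 face_s.
have wt0 := interior_vertex_neq0 Q0 (vertQ t).
rewrite sin_dihedral_angle// gramE subn2d ridgeE (vol_ridge r uE c_gt0 xE).
have parE : parallelepiped eps = parallelepiped (fun i => row i E).
  by congr parallelepiped; apply/funext => i; rewrite rowK.
have dotq j : `|dotv (w s) (q j)| = c 0 j * `|\det E|.
  rewrite /q dotvZr normrM normrX normrN1 expr1n mul1r.
  set X := cross _; have epsX l : `|dotv (eps l) X| = `|\det E| *+ (l == j).
    exact: dotv_cross_lift.
  (* In - w_s = sum_l c_l e_l only the term l = j has a nonzero product with q_j. *)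
  rewrite {1}xE dotvNl normrN mulmx_sum_row dotvC dotv_sumr (bigD1 j)//= big1.
    rewrite addr0 dotvZr rowK dotvC normrM epsX eqxx mulr1n gtr0_norm//.
  move=> l /negPf lj; rewrite dotvZr rowK dotvC; apply/eqP.
  by rewrite -normr_eq0 normrM epsX lj mulr0n mulr0.
rewrite (eq_bigr _ (fun j _ => dotq j)).
(* The k - 1 factors |det E| in the denominator against the k - 2 volumes in the numerator leave a
   single 1 / |det E|. *)
rewrite big_split prodr_const /= parE vol_parallelepiped//.
rewrite cardC1 card_ord /= exprS.
have P0 : \prod_(j | j != r) c 0 j != 0 by rewrite gt_eqF// prodr_gt0.
congr (- (_ * _)); field; rewrite P0 expf_neq0 ?gt_eqF//.
Qed.
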